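(* Let $p\in(0,1)$ and $p<t\le1$. Let $\beta=0$ and $h=h_q=\log\frac{q}{1-q}$ for some $q\in(0,1)$ with $q\ne t$. Then the importance sampling scheme (for the event $\mathcal{W}_t$ under $\mathbb{P}_{n,p}$) based on the edge tilt $\mathbb{Q}_n^{h_q,0,\alpha}$ is not asymptotically optimal.
   Context: **Graphons.** $\mathcal{W}$ is the set of measurable symmetric functions $f:[0,1]^2\to[0,1]$, modulo identifying $f$ and $g$ when $f(x,y)=g(\sigma x,\sigma y)$ for a measure-preserving bijection $\sigma$ of $[0,1]$. For $f\in\mathcal{W}$: $\mathcal{T}(f)=\int\int\int f(x,y)f(y,z)f(x,z)\,dx\,dy\,dz$ (integrals over $[0,1]$), and $\mathcal{W}_t=\{f\in\mathcal{W}:\mathcal{T}(f)\ge t^3\}$. **Rate function.** $I_p(u)=\frac12\left(u\log\frac up+(1-u)\log\frac{1-u}{1-p}\right)$ for $u\in[0,1]$ (with $0\log 0=0$), and $\mathcal{I}_p(f)=\int_0^1\int_0^1I_p(f(x,y))\,dx\,dy$. **Graphs.** $\Omega_n=\{0,1\}^{\binom n2}$ is the set of simple graphs $X$ on $n$ vertices. $X$ is identified with the graphon equal to $X_{ij}$ on $[\frac{i-1}n,\frac in)\times[\frac{j-1}n,\frac jn)$ ($X_{ji}=X_{ij}$, $X_{ii}=0$), so $\mathcal{T}(X)=\frac6{n^3}\#\{\text{triangles of }X\}$. $\mathbb{P}_{n,p}$ is the law of the Erdős–Rényi graph $\mathcal{G}_{n,p}$ (independent edges with probability $p$). **Edge tilt.**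 $\mathbb{Q}_n^{h,0,\alpha}$ is the probability measure on $\Omega_n$ with $\mathbb{Q}_n^{h,0,\alpha}(X)\propto e^{hE(X)}$, $E(X)$ the number of edges of $X$ ($\alpha$ is irrelevant when $\beta=0$); for $h=h_q$ this is $\mathbb{P}_{n,q}$. **Asymptotic optimality.** Importance sampling based on $\mathbb{Q}_n$ estimates $\mathbb{P}_{n,p}(\mathcal{W}_t)$ by averaging $\mathbf{1}_{\mathcal{W}_t}(\tilde X)\frac{d\mathbb{P}_{n,p}}{d\mathbb{Q}_n}(\tilde X)$ over i.i.d. samples $\tilde X\sim\mathbb{Q}_n$. The scheme based on $\mathbb{Q}_n$ is asymptotically optimal if $$\lim_{n\to\infty}\frac1{n^2}\log\mathbb{E}_{\mathbb{Q}_n}\left[\left(\mathbf{1}_{\mathcal{W}_t}\frac{d\mathbb{P}_{n,p}}{d\mathbb{Q}_n}\right)^2\right]=-2\inf_{f\in\mathcal{W}_t}\mathcal{I}_p(f)$$ (with $\log0=-\infty$). *)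

(* Defs.v *)
From HB Require Import structures.
From mathcomp Require Import all_boot all_order all_algebra.
From mathcomp Require Import all_classical all_reals all_analysis.

Set Implicit Arguments.
Unset Strict Implicit.
Unset Printing Implicit Defensive.

Import Order.TTheory GRing.Theory Num.Theory.
Import numFieldNormedType.Exports.

Local Open Scope classical_set_scope.
Local Open Scope ring_scope.

Definition unit_square (R : realType) :
    set (measurableTypeR R * measurableTypeR R) :=
  [set` `[0, 1]] `*` [set` `[0, 1]].

(* Graphons are handled through their representatives: [triangle_density] and
   [graphon_rate] are invariant under measure-preserving bijections of [0,1],
   so an infimum over equivalence classes is one over representatives.  Values
   outside [0,1]^2 are junk and are never used. *)
Record is_graphon (R : realType) (f : R * R -> R) : Prop := IsGraphon {
  graphon_measurable : measurable_fun (@unit_square R) f;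
  graphon_sym : forall x y : R,
    0 <= x <= 1 -> 0 <= y <= 1 -> f (x, y) = f (y, x);
  graphon_range : forall x y : R,
    0 <= x <= 1 -> 0 <= y <= 1 -> 0 <= f (x, y) <= 1
}.

Definition triangle_density (R : realType) (f : R * R -> R) : \bar R :=
  (\int[lebesgue_measure]_(x in `[0%R, 1%R])
   \int[lebesgue_measure]_(y in `[0%R, 1%R])
   \int[lebesgue_measure]_(z in `[0%R, 1%R])
     (f (x, y) * f (y, z) * f (x, z))%:E)%E.

Definition upper_tail (R : realType) (t : R) : set (R * R -> R) :=
  [set f | is_graphon f /\ ((t ^+ 3)%:E <= triangle_density f)%E].

(* [0 * ln 0 = 0] holds here since [ln 0 = 0] in the library. *)
Definition rate (R : realType) (p u : R) : R :=
  2^-1 * (u * ln (u / p) + (1 - u) * ln ((1 - u) / (1 - p))).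

Definition graphon_rate (R : realType) (p : R) (f : R * R -> R) : \bar R :=
  (\int[lebesgue_measure]_(x in `[0%R, 1%R])
   \int[lebesgue_measure]_(y in `[0%R, 1%R]) (rate p (f (x, y)))%:E)%E.

Definition vpair (n : nat) : finType := {e : 'I_n * 'I_n | (e.1 < e.2)%N}.

Definition graph (n : nat) : finType := {ffun vpair n -> bool}.

Definition adj (n : nat) (X : graph n) (i j : 'I_n) : bool :=
  [exists e : vpair n, X e && ((val e == (i, j)) || (val e == (j, i)))].

Definition num_edges (n : nat) (X : graph n) : nat := #|[pred e | X e]|.

(* Vertices are numbered from 0, so vertex [i] owns [[i/n, (i+1)/n)]. *)
Definition in_cell (R : realType) (n : nat) (i : 'I_n) (x : R) : bool :=
  i%:R / n%:R <= x < i.+1%:R / n%:R.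

Definition graph_graphon (R : realType) (n : nat) (X : graph n) (z : R * R) : R :=
  [exists i, exists j, [&& in_cell i z.1, in_cell j z.2 & adj X i j]]%:R.

(* Laws on the finite set [graph n] are given by their mass functions. *)
Definition erdos_renyi (R : realType) (p : R) (n : nat) (X : graph n) : R :=
  \prod_(e : vpair n) (if X e then p else 1 - p).

Definition edge_tilt (R : realType) (h : R) (n : nat) (X : graph n) : R :=
  expR (h * (num_edges X)%:R) / \sum_(Y : graph n) expR (h * (num_edges Y)%:R).

Definition expectation_mass (R : realType) (n : nat) (Q F : graph n -> R) : R :=
  \sum_(X : graph n) Q X * F X.

(* On a finite set, [dP/dQ] is the ratio of the mass functions. *)
Definition importance_weight (R : realType) (p t : R) (n : nat) (Q : graph n -> R)
    (X : graph n) : R :=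
  \1_[set Y : graph n | upper_tail t (@graph_graphon R n Y)] X
  * (erdos_renyi p X / Q X).

(* Convergence is in the extended reals, and [lne 0 = -oo]. *)
Definition asymptotically_optimal (R : realType) (p t : R)
    (Q : forall n, graph n -> R) : Prop :=
  (fun n : nat => ((n%:R ^+ 2)^-1)%:E *
     lne (expectation_mass (@Q n) (fun X => importance_weight p t (@Q n) X ^+ 2))%:E)%E
    @ \oo --> (- (2%:E * ereal_inf (graphon_rate p @` upper_tail t)))%E.

(* Main.v *)
Require Import Defs.
From mathcomp Require Import all_boot all_order all_algebra.
From mathcomp Require Import all_classical all_reals all_analysis.
From mathcomp Require Import measurable_realfun ring lra.

Set Implicit Arguments.
Unset Strict Implicit.
Unset Printing Implicit Defensive.

Import Order.TTheory GRing.Theory Num.Theory.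
Import numFieldNormedType.Exports.
Local Open Scope classical_set_scope.
Local Open Scope ring_scope.

(** The second moment of the importance sampling weight is the sum, over the
    graphs [X] of the upper tail, of [P(X) ^ 2 / Q(X)], where [P] and [Q] are the
    product Bernoulli laws with edge probabilities [p] and [q]. On graphs that
    look like a graphon [f], this quantity has exponential rate (at scale
    [n ^ 2]) [- (2 I_p(f) - I_q(f))], entropy included. So its limit is at least
    [- inf (2 I_p - I_q)], and asymptotic optimality fails as soon as some [f] of
    the upper tail satisfies [2 I_p(f) - I_q(f) < 2 inf I_p].

    Such an [f] exists because a near-minimiser of [I_p] cannot have small
    [I_q], i.e. cannot be close to the constant [q] ([near_minimiser_rate_lb]).
    If [q < t], graphons close to [q] have too few triangles. If [q > t], they
    have [I_p] close to [I_p(q) > I_p(t)], and the constant [t] already does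
    better.

    The lower bound on the second moment is by a change of measure.
    When [t < 1], [f] is first pushed towards 1, which makes its triangle density
    exceed [t ^ 3] strictly, then slightly towards 0, which bounds its values away
    from 0 and 1 ([interior_perturbation]). It is then replaced by a step
    function on a uniform grid, by density in L1 ([step_graphon_approx]), both
    functionals being L1-Lipschitz; the outcome is a finite symmetric matrix
    ([step_matrix_gap]). Along [n = (m + 1)(k + 1)], let [mu] be the law of
    independent edges with the probabilities of the blown-up matrix. Its triangle
    density has variance [O(1 / n)], so [mu] concentrates on the upper tail
    ([triangle_avg_concentration]), and the Gibbs inequality
    ([gibbs_lower_bound]) bounds the second moment below by the relative entropy
    of [mu], which gives [step_lower_bound]. A subsequence suffices to contradict
    the convergence.

    When [t = 1] the second moment vanishes, because graphs have no loops, and its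
    logarithm diverges, whereas the claimed limit is finite. *)

(** * Means of bounded measurable functions *)

(** A class closed under all the operations used below, on which every
    integral against a probability is a finite real number: linearity,
    monotonicity and Fubini then hold with no integrability side condition. *)
Definition bounded_measurable d (T : measurableType d) (R : realType)
    (F : T -> R) :=
  measurable_fun setT F /\ exists M, forall x, `|F x| <= M.

Section bounded_measurable.
Context d (T : measurableType d) (R : realType).
Implicit Types (F G : T -> R) (A : set T).

Lemma bounded_measurable_cst (c : R) : bounded_measurable (fun _ : T => c).
Proof. by split; [exact: measurable_cst|exists `|c|]. Qed.

Lemma bounded_measurableD F G : bounded_measurable F -> bounded_measurable G ->
  bounded_measurable (fun x => F x + G x).
Proof.
move=> [mF [M FM]] [mG [N GN]]; split; first exact: measurable_funD.
by exists (M + N) => x; rewrite (le_trans (ler_normD _ _))// lerD.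
Qed.

Lemma bounded_measurableM F G : bounded_measurable F -> bounded_measurable G ->
  bounded_measurable (fun x => F x * G x).
Proof.
move=> [mF [M FM]] [mG [N GN]]; split; first exact: measurable_funM.
by exists (M * N) => x; rewrite normrM ler_pM.
Qed.

Lemma bounded_measurableZ (c : R) F : bounded_measurable F ->
  bounded_measurable (fun x => c * F x).
Proof. by apply: bounded_measurableM; exact: bounded_measurable_cst. Qed.

Lemma bounded_measurableB F G : bounded_measurable F -> bounded_measurable G ->
  bounded_measurable (fun x => F x - G x).
Proof.
move=> bF bG; have := bounded_measurableD bF (bounded_measurableZ (-1) bG).
by congr bounded_measurable; apply/funext => x; rewrite mulN1r.
Qed.

Lemma bounded_measurable_norm F : bounded_measurable F ->
  bounded_measurable (fun x => `|F x|).
Proof.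
move=> [mF [M FM]]; split; first exact: measurableT_comp.
by exists M => x; rewrite normr_id.
Qed.

Lemma bounded_measurable_sum (I : Type) (r : seq I) (H : I -> T -> R) :
  (forall i, bounded_measurable (H i)) ->
  bounded_measurable (fun x => \sum_(i <- r) H i x).
Proof.
move=> bH; elim: r => [|i r IH].
  by under eq_fun do rewrite big_nil; exact: bounded_measurable_cst.
by under eq_fun do rewrite big_cons; exact: bounded_measurableD.
Qed.

Lemma bounded_measurable_indic A : measurable A ->
  bounded_measurable (\1_A : T -> R).
Proof.
move=> mA; split; first exact: measurable_indic.
by exists 1 => x; rewrite indicE; case: (_ \in _); rewrite ?normr1 ?normr0.
Qed.

Lemma bounded_measurable_comp d' (T' : measurableType d') (h : T' -> T) F :
  measurable_fun setT h -> bounded_measurable F ->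
  bounded_measurable (fun x => F (h x)).
Proof.
move=> mh [mF [M FM]]; split; first exact: measurableT_comp.
by exists M => x; exact: FM.
Qed.

Variable P : probability T R.

Lemma bounded_integrable F : bounded_measurable F ->
  P.-integrable setT (EFin \o F).
Proof.
move=> [mF [M FM]]; apply: measurable_bounded_integrable => //.
  by apply: (le_lt_trans (probability_le1 P measurableT)); rewrite ltry.
exists M; split; first exact: num_real.
by move=> N MN x _; apply: le_trans (FM x) _; exact: ltW.
Qed.

Lemma mean_EFin F : bounded_measurable F ->
  (\int[P]_x (F x)%:E)%E = (\int[P]_x F x)%:E.
Proof.
move=> bF; rewrite /Rintegral fineK//; apply: integrable_fin_num => //.
exact: bounded_integrable.
Qed.

Lemma mean_cst (c : R) : \int[P]_x c = c.
Proof.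
rewrite Rintegral_cst//; have -> : fine (P [set: T]) = 1; last by rewrite mulr1.
by rewrite -[RHS]/(fine 1%E); congr fine; exact: probability_setT.
Qed.

Lemma meanD F G : bounded_measurable F -> bounded_measurable G ->
  \int[P]_x (F x + G x) = \int[P]_x F x + \int[P]_x G x.
Proof. by move=> bF bG; apply: RintegralD => //; exact: bounded_integrable. Qed.

Lemma meanB F G : bounded_measurable F -> bounded_measurable G ->
  \int[P]_x (F x - G x) = \int[P]_x F x - \int[P]_x G x.
Proof. by move=> bF bG; apply: RintegralB => //; exact: bounded_integrable. Qed.

Lemma meanZ (c : R) F : bounded_measurable F ->
  \int[P]_x (c * F x) = c * \int[P]_x F x.
Proof. by move=> bF; apply: RintegralZl => //; exact: bounded_integrable. Qed.

Lemma mean_sum (I : Type) (r : seq I) (H : I -> T -> R) :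
  (forall i, bounded_measurable (H i)) ->
  \int[P]_x (\sum_(i <- r) H i x) = \sum_(i <- r) \int[P]_x H i x.
Proof.
move=> bH; elim: r => [|i r IH].
  by rewrite big_nil; under eq_Rintegral do rewrite big_nil; rewrite mean_cst.
rewrite big_cons -IH -meanD//; last exact: bounded_measurable_sum.
by apply: eq_Rintegral => x _; rewrite big_cons.
Qed.

Lemma le_mean F G : bounded_measurable F -> bounded_measurable G ->
  (forall x, F x <= G x) -> \int[P]_x F x <= \int[P]_x G x.
Proof.
by move=> bF bG FG; apply: le_Rintegral => //; exact: bounded_integrable.
Qed.

Lemma mean_indic A : measurable A -> \int[P]_x (\1_A x : R) = fine (P A).
Proof. by move=> mA; rewrite /Rintegral integral_indic// setIT. Qed.

Lemma mean_itv F (a b : R) : bounded_measurable F -> (forall x, a <= F x <= b) ->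
  a <= \int[P]_x F x <= b.
Proof.
move=> bF Fab; rewrite -{1}(mean_cst a) -[X in _ <= _ <= X](mean_cst b).
apply/andP; split; apply: le_mean => //; try exact: bounded_measurable_cst.
  by move=> x; case/andP: (Fab x).
by move=> x; case/andP: (Fab x).
Qed.

End bounded_measurable.

Section iterated_means.
Context d1 d2 (T1 : measurableType d1) (T2 : measurableType d2) (R : realType).
Variables (P1 : probability T1 R) (P2 : probability T2 R).
Implicit Types F : T1 * T2 -> R.

Lemma bounded_measurable_pair1 F x : bounded_measurable F ->
  bounded_measurable (fun y => F (x, y)).
Proof. by apply: bounded_measurable_comp; exact: pair1_measurable. Qed.

Lemma bounded_measurable_pair2 F y : bounded_measurable F ->
  bounded_measurable (fun x => F (x, y)).
Proof. by apply: bounded_measurable_comp; exact: pair2_measurable. Qed.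

Lemma bounded_measurable_mean F : bounded_measurable F ->
  bounded_measurable (fun x => \int[P2]_y F (x, y)).
Proof.
move=> bF; have [mF [M FM]] := bF; split; last first.
  exists M => x; rewrite ler_norml; apply: mean_itv.
    exact: bounded_measurable_pair1.
  by move=> y; rewrite -ler_norml.
apply/measurable_EFinP.
rewrite [X in measurable_fun _ X](_ : _ = fubini_F P2 (EFin \o F)).
  exact: (measurable_fubini_F (m1 := P1) (bounded_integrable (P1 \x P2)%E bF)).
apply/funext => x; rewrite /fubini_F /= mean_EFin//.
exact: bounded_measurable_pair1.
Qed.

Lemma mean_prod F : bounded_measurable F ->
  \int[(P1 \x P2)%E]_z F z = \int[P1]_x \int[P2]_y F (x, y).
Proof.
move=> bF; apply: EFin_inj; rewrite -(mean_EFin (P1 \x P2)%E bF).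
rewrite -(mean_EFin P1 (bounded_measurable_mean bF)).
have := integral12_prod_meas1 (bounded_integrable (P1 \x P2)%E bF) => /= <-.
apply: eq_integral => x _; rewrite /fubini_F /= mean_EFin//.
exact: bounded_measurable_pair1.
Qed.

End iterated_means.

Lemma mean_swap d1 d2 (T1 : measurableType d1) (T2 : measurableType d2)
    (R : realType) (P1 : probability T1 R) (P2 : probability T2 R)
    (F : T1 * T2 -> R) : bounded_measurable F ->
  \int[P1]_x \int[P2]_y F (x, y) = \int[P2]_y \int[P1]_x F (x, y).
Proof.
move=> bF; have bF' : bounded_measurable (fun z : T2 * T1 => F (z.2, z.1)).
  by apply: bounded_measurable_comp => //; exact: measurable_swap.
apply: EFin_inj.
rewrite -(mean_EFin P1 (bounded_measurable_mean P1 P2 bF)).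
rewrite -(mean_EFin P2 (bounded_measurable_mean P2 P1 bF')).
have := Fubini (bounded_integrable (P1 \x P2)%E bF) => /= FF.
transitivity (\int[P1]_x \int[P2]_y (F (x, y))%:E)%E.
  apply: eq_integral => x _; rewrite mean_EFin//.
  exact: bounded_measurable_pair1.
rewrite FF; apply: eq_integral => x _; rewrite mean_EFin//.
exact: bounded_measurable_pair2.
Qed.

(** * Density in L1 by the pi-lambda theorem *)

Definition L1_approximable d (T : measurableType d) (R : realType)
    (P : probability T R) (S : set (T -> R)) (F : T -> R) :=
  forall e, 0 < e -> exists2 s, S s & \int[P]_x `|F x - s x| < e.

Section L1_density.
Context d (T : measurableType d) (R : realType) (P : probability T R).
Variable S : set (T -> R).
Hypothesis S_bounded : forall s, S s -> bounded_measurable s.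
Hypothesis S_cst : forall c, S (fun=> c).
Hypothesis S_lin : forall c s s', S s -> S s' -> S (fun x => c * s x + s' x).
Implicit Types (F G : T -> R) (A : set T).

Local Notation approximable := (L1_approximable P S).

Lemma approximable_in F : S F -> approximable F.
Proof.
move=> SF e e0; exists F => //.
by under eq_Rintegral do rewrite subrr normr0; rewrite mean_cst.
Qed.

Lemma approximable_lin c F G : bounded_measurable F -> bounded_measurable G ->
  approximable F -> approximable G -> approximable (fun x => c * F x + G x).
Proof.
move=> bF bG aF aG e e0.
have d0 : 0 < e / 2 / (`|c| + 1) by rewrite !divr_gt0// ltr_wpDl.
have [s Ss Fs] := aF _ d0; have [s' Ss' Gs'] := aG (e / 2) (divr_gt0 e0 (ltr0Sn _ _)).
exists (fun x => c * s x + s' x); first exact: S_lin.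
have bs := S_bounded Ss; have bs' := S_bounded Ss'.
apply: (@le_lt_trans _ _ (`|c| * \int[P]_x `|F x - s x| +
                          \int[P]_x `|G x - s' x|)).
  rewrite -meanZ; last exact/bounded_measurable_norm/bounded_measurableB.
  rewrite -meanD; last 2 first.
  - exact/bounded_measurableZ/bounded_measurable_norm/bounded_measurableB.
  - exact/bounded_measurable_norm/bounded_measurableB.
  apply: le_mean.
  - apply/bounded_measurable_norm/bounded_measurableB;
      by apply: bounded_measurableD => //; exact: bounded_measurableZ.
  - apply: bounded_measurableD;
      last exact/bounded_measurable_norm/bounded_measurableB.
    exact/bounded_measurableZ/bounded_measurable_norm/bounded_measurableB.
  - move=> x; rewrite -normrM; apply: le_trans (ler_normD _ _).
    by rewrite le_eqVlt; apply/orP; left; apply/eqP; congr `|_|; ring.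
rewrite [e]splitr ler_ltD//.
apply: (@le_trans _ _ ((`|c| + 1) * \int[P]_x `|F x - s x|)).
  by rewrite ler_wpM2r// ?lerDl//; apply: Rintegral_ge0.
by rewrite mulrC -ler_pdivlMr ?ltW// ltr_wpDl.
Qed.

Lemma approximable_closed F : bounded_measurable F ->
  (forall e, 0 < e -> exists G, [/\ bounded_measurable G, approximable G &
     \int[P]_x `|F x - G x| <= e]) -> approximable F.
Proof.
move=> bF FG e e0; have [G [bG aG Ge]] := FG (e / 2) (divr_gt0 e0 (ltr0Sn _ _)).
have [s Ss Gs] := aG (e / 2) (divr_gt0 e0 (ltr0Sn _ _)); exists s => //.
have bs := S_bounded Ss.
rewrite [e]splitr; apply: le_lt_trans (ler_ltD Ge Gs).
have bFG := bounded_measurable_norm (bounded_measurableB bF bG).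
have bGs := bounded_measurable_norm (bounded_measurableB bG bs).
rewrite -meanD//; apply: le_mean.
- exact/bounded_measurable_norm/bounded_measurableB.
- exact: bounded_measurableD.
- by move=> x; rewrite -[F x - s x](subrKA (G x)) ler_normD.
Qed.

Lemma approximable_sum (I : Type) (r : seq I) (H : I -> T -> R) :
  (forall k, bounded_measurable (H k)) -> (forall k, approximable (H k)) ->
  approximable (fun x => \sum_(k <- r) H k x).
Proof.
move=> bH aH; elim: r => [|k r IH].
  under eq_fun do rewrite big_nil.
  exact/approximable_in/S_cst.
have := approximable_lin 1 (bH k) (bounded_measurable_sum r bH) (aH k) IH.
by congr L1_approximable; apply/funext => x; rewrite big_cons mul1r.
Qed.

Lemma approximable_setC A : measurable A -> approximable (\1_A) ->
  approximable (\1_(~` A)).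
Proof.
move=> mA aA.
have := approximable_lin (-1) (bounded_measurable_indic R mA)
  (bounded_measurable_cst _ 1) aA (approximable_in (S_cst 1)).
congr L1_approximable; apply/funext => x.
by rewrite !indicE in_setC; case: (x \in A); rewrite /= ?mulr1 ?mulr0 ?addNr ?add0r.
Qed.

(** By sigma-additivity the first N terms of a disjoint union carry all of its
    mass but an arbitrarily small part, so finite sums suffice. *)
Lemma approximable_bigcup (F : (set T)^nat) : (forall n, measurable (F n)) ->
  trivIset setT F -> (forall n, approximable (\1_(F n))) ->
  approximable (\1_(\bigcup_k F k)).
Proof.
move=> mF tF aF; have mU : measurable (\bigcup_k F k) by exact: bigcup_measurable.
have bU := bounded_measurable_indic R mU.
have bF n := bounded_measurable_indic R (mF n).
apply: approximable_closed => // e e0.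
have /fine_cvgP[_] : (\sum_(0 <= i < n) P (F i))%E @[n --> \oo] -->
    (fine (P (\bigcup_k F k)))%:E.
  rewrite fineK ?fin_num_measure//.
  exact: measure_semi_sigma_additive.
move=> /cvgrPdist_lt/(_ _ e0)[N _ /(_ N (leqnn N))] /= PN.
exists (fun x => \sum_(k < N) (\1_(F k) x)); split.
- exact: bounded_measurable_sum.
- exact: approximable_sum.
have le1 x : \sum_(k < N) (\1_(F k) x) <= (\1_(\bigcup_k F k) x : R).
  have [[k0 Fk0]|nFx] := pselect (exists k, F k x); last first.
    rewrite big1 ?indicE// => k _; rewrite indicE memNset//.
    by move=> Fkx; apply: nFx; exists k.
  have Fk k : k <> k0 -> (\1_(F k) x : R) = 0.
    move=> kk0; rewrite indicE memNset// => Fkx; apply: kk0.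
    by apply: (tF _ _ Logic.I Logic.I); exists x.
  rewrite [leRHS]indicE mem_set; last by exists k0.
  have [k0N|Nk0] := ltnP k0 N; last first.
    by rewrite big1// => k _; apply: Fk => kk0; rewrite -kk0 leqNgt ltn_ord in Nk0.
  rewrite (bigD1 (Ordinal k0N))//= big1 ?addr0; last first.
    by move=> k /eqP kk0; apply: Fk => kE; apply: kk0; exact: val_inj.
  by rewrite indicE; case: (_ \in _).
under eq_Rintegral do rewrite ger0_norm ?subr_ge0//.
rewrite meanB//; last exact: bounded_measurable_sum.
rewrite mean_sum// mean_indic//.
under eq_bigr do rewrite mean_indic//.
apply: le_trans (ltW PN); apply: le_trans (ler_norm _).
rewrite lerD2l lerN2 le_eqVlt; apply/orP; left; apply/eqP.
rewrite -[RHS]/(fine (\sum_(i < N) fine (P (F i)))%:E) -sumEFin big_mkord.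
by congr fine; apply: eq_bigr => k _; rewrite fineK// fin_num_measure.
Qed.

(** The sets with an approximable indicator form a lambda-system. *)
Lemma approximable_measurable (G : set (set T)) :
  @measurable _ T = <<s G >> -> setI_closed G ->
  (forall A, G A -> approximable (\1_A)) ->
  forall A, measurable A -> approximable (\1_A).
Proof.
move=> GE GI GA A; rewrite GE.
apply: (@dynkin_induction _ T G (fun A => approximable \1_A)) => //.
- by rewrite indicT; exact/approximable_in/S_cst.
- exact: approximable_setC.
- exact: approximable_bigcup.
Qed.

(** The sum is [e * floor (y / e)]: counting the layers of height [e] below [y]
    discretises [y] with error at most [e], using only indicators of
    superlevel sets of [y]. *)
Lemma layer_sum (e y : R) N : 0 < e -> 0 <= y <= N%:R * e ->
  0 <= y - \sum_(k < N) e * ((k.+1%:R * e <= y)%R)%:R <= e.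
Proof.
move=> e0; elim: N => [|N IH] /andP[y0].
  by rewrite mul0r => ?; rewrite big_ord0; lra.
rewrite big_ord_recr /= => yN; have [yN'|Ny] := leP y (N%:R * e).
  rewrite (_ : (N.+1%:R * e <= y) = false) ?mulr0 ?addr0; first by apply: IH; lra.
  by apply/negbTE; rewrite -ltNge -natr1; nra.
have -> : \sum_(k < N) e * ((k.+1%:R * e <= y)%R)%:R = N%:R * e.
  rewrite (eq_bigr (fun=> e)) ?sumr_const ?card_ord ?mulr_natl// => k _.
  suff -> : k.+1%:R * e <= y by rewrite mulr1.
  by apply: le_trans (ltW Ny); rewrite ler_pM2r// ler_nat.
rewrite -natr1 in yN *; have [/= | /=] := leP ((N%:R + 1) * e) y; lra.
Qed.

(** Approximating the indicators of a generating pi-system is enough: the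
    pi-lambda theorem extends this to all measurable sets, and a bounded
    function is within [e] of a finite combination of indicators. *)
Lemma L1_density (G : set (set T)) :
  @measurable _ T = <<s G >> -> setI_closed G ->
  (forall A, G A -> approximable (\1_A)) ->
  forall F, bounded_measurable F -> approximable F.
Proof.
move=> GE GI GA F bF; have [mF [M FM]] := bF.
apply: approximable_closed => // e e0.
pose B k := [set x | k.+1%:R * e <= F x + M].
have mB k : measurable (B k).
  have mFM : measurable_fun setT (fun x => F x + M).
    by apply: measurable_funD => //; exact: measurable_cst.
  rewrite -[B k]setTI.
  rewrite [X in _ `&` X](_ : _ = (fun x => F x + M) @^-1` `[k.+1%:R * e, +oo[).
    by apply: mFM => //; exact: measurable_itv.
  by apply/seteqP; split => x /=; rewrite in_itv /= andbT.
(* Enough layers to reach the top of [F + M], which ranges over [0, 2M]. *)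
pose N := (Num.truncn ((M + M) / e)).+1.
have aB k := approximable_measurable GE GI GA (mB k).
have bB k := bounded_measurable_indic R (mB k).
exists (fun x => e * (\sum_(k < N) \1_(B k) x) + - M); split.
- apply: bounded_measurableD; last exact: bounded_measurable_cst.
  exact/bounded_measurableZ/bounded_measurable_sum.
- apply: approximable_lin; [exact: bounded_measurable_sum| | |].
  + exact: bounded_measurable_cst.
  + exact: approximable_sum.
  + exact/approximable_in/S_cst.
rewrite -[leRHS](mean_cst P); apply: le_mean.
- apply/bounded_measurable_norm/bounded_measurableB => //.
  apply: bounded_measurableD; last exact: bounded_measurable_cst.
  exact/bounded_measurableZ/bounded_measurable_sum.
- exact: bounded_measurable_cst.
move=> x.
have FMN : 0 <= F x + M <= N%:R * e.
  have := FM x; rewrite ler_norml => /andP[F1 F2].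
  apply/andP; split; first by lra.
  rewrite -ler_pdivrMr//; apply: le_trans (ltW (Num.Theory.truncnS_gt _)).
  by rewrite ler_pM2r ?invr_gt0//; lra.
have := layer_sum e0 FMN.
rewrite -big_distrr /=.
under eq_bigr do rewrite -/(B _ x).
have -> : \sum_(k < N) \1_(B k) x = \sum_(k < N) ((k.+1%:R * e <= F x + M)%R)%:R :> R.
  apply: eq_bigr => k _; rewrite indicE; congr (nat_of_bool _)%:R.
  by apply/idP/idP; rewrite inE.
by move=> /andP[? ?]; rewrite ger0_norm; lra.
Qed.

End L1_density.

(** * The uniform law and the uniform grid on the unit interval *)

(** Integrals over [0,1] become means of globally defined functions, so that no
    integration domain has to be carried along. *)
Definition unif01 (R : realType) : probability (measurableTypeR R) R :=
  uniform_prob (@ltr01 R).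

Section unit_interval.
Variable R : realType.
Local Notation U := (@unif01 R).
Local Notation lambda := (@lebesgue_measure R).
Implicit Types (F G : measurableTypeR R -> R) (A : set (measurableTypeR R)).

Lemma integral_unif01 (F : measurableTypeR R -> \bar R) :
  measurable_fun setT F -> (forall x, 0 <= F x)%E ->
  (\int[lambda]_(x in `[0%R, 1%R]) F x = \int[U]_x F x)%E.
Proof. by move=> mF F0; rewrite integral_uniform// subr0 invr1 mul1e. Qed.

Lemma unif01_indic A : measurable A ->
  \int[U]_x (\1_A x : R) = fine (lambda (`[0, 1]%classic `&` A)).
Proof.
move=> mA; rewrite /Rintegral -integral_unif01//.
  by rewrite integral_indic// setIC.
exact/measurable_EFinP/measurable_indic.
Qed.

Lemma unif01_co (a b : R) : 0 <= a -> a <= b -> b <= 1 ->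
  \int[U]_x (\1_(`[a, b[%classic) x : R) = b - a.
Proof.
move=> a0 ab b1; rewrite unif01_indic; last exact: measurable_itv.
rewrite (_ : _ `&` _ = `[a, b[%classic).
  rewrite lebesgue_measure_itv/=. rewrite lte_fin -EFinD.
  by case: ltgtP ab => //= ->; rewrite subrr.
apply/seteqP; split => x /=; first by case.
rewrite !in_itv/= => /andP[ax xb].
by rewrite ax xb (le_trans a0 ax) (le_trans (ltW xb)).
Qed.

(** Values outside [0,1) do not matter, the point 1 being a null set; adding a
    large multiple of the indicator of the complement of [0,1) makes the
    comparison global. *)
Lemma le_mean_unif01 F G : bounded_measurable F -> bounded_measurable G ->
  (forall x, 0 <= x < 1 -> F x <= G x) -> \int[U]_x F x <= \int[U]_x G x.
Proof.
move=> bF bG FG; have [_ [M FM]] := bF; have [_ [N GN]] := bG.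
have bI : bounded_measurable (\1_(`[0, 1[%classic) : measurableTypeR R -> R).
  by apply: bounded_measurable_indic; exact: measurable_itv.
have bJ := bounded_measurableZ (M + N)
  (bounded_measurableB (bounded_measurable_cst _ 1) bI).
(* The added term has mean zero and dominates [F - G] off [0,1). *)
have -> : \int[U]_x G x =
    \int[U]_x (G x + (M + N) * (1 - \1_(`[0, 1[%classic) x)).
  rewrite meanD// meanZ ?meanB ?mean_cst ?unif01_co ?subr0 ?subrr ?mulr0 ?addr0//.
  - exact: bounded_measurable_cst.
  - exact/bounded_measurableB/bI/bounded_measurable_cst.
apply: le_mean => //; first exact: bounded_measurableD.
move=> x; have [x01|x01] := boolP (0 <= x < 1).
  by rewrite indicE mem_set /= ?in_itv//= subrr mulr0 addr0 FG.
rewrite indicE memNset /= ?in_itv/=; last exact/negP.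
have := FM x; have := GN x; rewrite !ler_norml => /andP[? ?] /andP[? ?].
by rewrite subr0 mulr1; lra.
Qed.

Lemma eq_mean_unif01 F G : bounded_measurable F -> bounded_measurable G ->
  (forall x, 0 <= x < 1 -> F x = G x) -> \int[U]_x F x = \int[U]_x G x.
Proof.
move=> bF bG FG; apply/le_anti/andP; split; apply: le_mean_unif01 => // x x01;
  by rewrite FG.
Qed.

End unit_interval.

Section grid.
Variable R : realType.
Local Notation U := (@unif01 R).

(** Off [0,1) every point is sent to the first cell. This is harmless for the
    uniform law and keeps [cell] a total function that commutes with
    refinement of the grid everywhere. *)
Definition cell (n : nat) (x : R) : 'I_n.+1 := odflt ord0 [pick i | in_cell i x].

Lemma in_cell_inj n (i j : 'I_n.+1) (x : R) : in_cell i x -> in_cell j x -> i = j.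
Proof.
suff H (i' j' : 'I_n.+1) : in_cell i' x -> in_cell j' x -> (i' <= j')%N.
  by move=> ix jx; apply/val_inj/anti_leq; rewrite !H.
move=> /andP[ix _] /andP[_ xj]; rewrite -ltnS -(@ltr_nat R).
by rewrite -(@ltr_pM2r _ (n.+1%:R^-1)) ?invr_gt0 ?ltr0n// (le_lt_trans ix).
Qed.

Lemma in_cell_itv n (i : 'I_n.+1) (x : R) : in_cell i x -> 0 <= x < 1.
Proof.
move=> /andP[ix xi]; apply/andP; split; first exact: le_trans ix.
apply: lt_le_trans xi _; rewrite ler_pdivrMr ?ltr0n// mul1r ler_nat.
exact: ltn_ord.
Qed.

Lemma cell_eq n (i : 'I_n.+1) (x : R) : in_cell i x -> cell n x = i.
Proof.
rewrite /cell => ix; case: pickP => [j jx /=|/(_ i)]; last by rewrite ix.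
exact: in_cell_inj jx ix.
Qed.

Lemma in_cell_cell n (x : R) : 0 <= x < 1 -> in_cell (cell n x) x.
Proof.
move=> /andP[x0 x1]; pose k := Num.truncn (x * n.+1%:R).
have kP : k%:R <= x * n.+1%:R < k.+1%:R.
  by apply: truncn_itv; rewrite mulr_ge0.
have kn : (k < n.+1)%N.
  rewrite -(@ltr_nat R); case/andP: kP => /le_lt_trans -> //.
  by rewrite -[ltRHS]mul1r ltr_pM2r ?ltr0n.
have ix : in_cell (Ordinal kn) x.
  by rewrite /in_cell /= ler_pdivrMr ?ltr0n// ltr_pdivlMr ?ltr0n.
by rewrite (cell_eq ix).
Qed.

Lemma cell_out n (x : R) : ~~ (0 <= x < 1) -> cell n x = ord0.
Proof.
rewrite /cell => x01; case: pickP => [i ix|//].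
by rewrite (in_cell_itv ix) in x01.
Qed.

(** The grid of mesh 1/(n+1)(m+1) refines the one of mesh 1/(n+1), so two step
    functions always live on a common grid. *)
Lemma cell_refine n m x : cell n x = inord (cell (n.+1 * m.+1).-1 x %/ m.+1).
Proof.
have [x01|x01] := boolP (0 <= x < 1); last first.
  by rewrite !cell_out//; apply: val_inj; rewrite /= div0n inordK.
have := ltn_ord (cell (n.+1 * m.+1).-1 x).
have := in_cell_cell (n.+1 * m.+1).-1 x01; rewrite /in_cell.
move: (nat_of_ord (cell _ x)) => k; rewrite prednK ?muln_gt0// => kx kP.
have km : (k %/ m.+1 < n.+1)%N by rewrite ltn_divLR.
apply: cell_eq; move: kx; rewrite /in_cell inordK//.
move=> /andP[kx xk]; have n0 : 0 < (n.+1%:R : R) by rewrite ltr0n.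
have m0 : 0 < (m.+1%:R : R) by rewrite ltr0n.
rewrite ler_pdivrMr// ltr_pdivlMr//.
rewrite natrM invfM mulrA ler_pdivrMr// ler_pdivrMr// in kx.
rewrite natrM invfM mulrA ltr_pdivlMr// ltr_pdivlMr// in xk.
rewrite -(ler_pM2r m0) -(ltr_pM2r m0).
have -> : x * n.+1%:R * m.+1%:R = x * m.+1%:R * n.+1%:R by ring.
rewrite -!natrM; apply/andP; split.
  by apply: le_trans _ _; last (apply: le_trans kx _); rewrite ?ler_nat ?leq_divM.
by apply: lt_le_trans (_ : k.+1%:R <= _) => //; rewrite ?ler_nat ?ltn_ceil//; lra.
Qed.

(** Writing a step function as a combination of indicators of half-open
    intervals gives at once its measurability and its mean. *)
Lemma cellE n (a : 'I_n.+1 -> R) (x : R) : a (cell n x) =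
  a ord0 + \sum_(i < n.+1) (a i - a ord0) *
    \1_(`[i%:R / n.+1%:R, i.+1%:R / n.+1%:R[%classic) x.
Proof.
have E (i : 'I_n.+1) :
    \1_(`[i%:R / n.+1%:R, i.+1%:R / n.+1%:R[%classic) x = (in_cell i x)%:R :> R.
  by rewrite indicE; congr (nat_of_bool _)%:R; apply/idP/idP; rewrite inE /= in_itv.
under eq_bigr do rewrite E.
have [x01|x01] := boolP (0 <= x < 1); last first.
  rewrite cell_out// big1 ?addr0// => i _.
  case: (boolP (in_cell i x)) => [/in_cell_itv|]; last by rewrite mulr0.
  by rewrite (negbTE x01).
have cx := in_cell_cell n x01.
rewrite (bigD1 (cell n x))//= cx mulr1 big1.
  by rewrite addr0 addrC subrK.
move=> i ix.
case: (boolP (in_cell i x)) => [/in_cell_inj/(_ cx)|]; last by rewrite mulr0.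
by move=> E'; rewrite E' eqxx in ix.
Qed.

Lemma bounded_measurable_cell n (a : 'I_n.+1 -> R) :
  bounded_measurable (fun x : measurableTypeR R => a (cell n x)).
Proof.
under eq_fun do rewrite cellE.
apply: bounded_measurableD; first exact: bounded_measurable_cst.
apply: bounded_measurable_sum => i; apply/bounded_measurableZ.
by apply: bounded_measurable_indic; exact: measurable_itv.
Qed.

Lemma mean_cell n (a : 'I_n.+1 -> R) :
  \int[U]_x a (cell n x) = n.+1%:R^-1 * \sum_(i < n.+1) a i.
Proof.
have n0 : (n.+1%:R : R) != 0 by rewrite pnatr_eq0.
under eq_Rintegral do rewrite cellE.
have bI (i : 'I_n.+1) : bounded_measurable (fun x : measurableTypeR R =>
    (\1_(`[i%:R / n.+1%:R, i.+1%:R / n.+1%:R[%classic) x : R)).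
  by apply: bounded_measurable_indic; exact: measurable_itv.
rewrite meanD; last 2 first.
- exact: bounded_measurable_cst.
- by apply: bounded_measurable_sum => i; exact: bounded_measurableZ.
rewrite mean_cst mean_sum; last by move=> i; exact: bounded_measurableZ.
rewrite (eq_bigr (fun i : 'I_n.+1 => n.+1%:R^-1 * (a i - a ord0))).
  rewrite -big_distrr /= sumrB sumr_const card_ord mulrBr -[a ord0 *+ _]mulr_natl.
  by rewrite mulrA mulVf// mul1r addrC subrK.
move=> i _; rewrite meanZ// unif01_co.
- by rewrite -mulrBl -natrB ?leqnSn// subSnn mul1r mulrC.
- by rewrite divr_ge0.
- by rewrite ler_pM2r ?invr_gt0 ?ltr0n// ler_nat.
- by rewrite ler_pdivrMr ?ltr0n// mul1r ler_nat.
Qed.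

End grid.

(** * Step functions on a common grid *)

Section step_functions.
Variable R : realType.
Local Notation U := (@unif01 R).
Local Notation I := (measurableTypeR R).

(** Step functions on a uniform grid of unspecified mesh. Uniform cells make
    the blocks of the graphs built from such a function equally large. *)
Definition step_fun1 : set (I -> R) :=
  [set s | exists n (a : 'I_n.+1 -> R), s = fun x => a (cell n x)].

Definition step_fun2 : set (I * I -> R) :=
  [set s | exists n (a : 'I_n.+1 -> 'I_n.+1 -> R),
     s = fun z => a (cell n z.1) (cell n z.2)].

Lemma step_fun1_bounded s : step_fun1 s -> bounded_measurable s.
Proof. by case=> n [a ->]; exact: bounded_measurable_cell. Qed.

Lemma step_fun1_cst c : step_fun1 (fun=> c).
Proof. by exists 0, (fun=> c). Qed.

Lemma cell_refine2 n m (x : R) : cell m x = inord (cell (n.+1 * m.+1).-1 x %/ n.+1).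
Proof. by rewrite mulnC -cell_refine. Qed.

Lemma step_fun1_lin c s s' : step_fun1 s -> step_fun1 s' ->
  step_fun1 (fun x => c * s x + s' x).
Proof.
case=> n [a ->] [m [b ->]]; exists (n.+1 * m.+1).-1,
  (fun k => c * a (inord (k %/ m.+1)) + b (inord (k %/ n.+1))).
by apply/funext => x; rewrite -cell_refine -cell_refine2.
Qed.

Lemma step_fun2_cst c : step_fun2 (fun=> c).
Proof. by exists 0, (fun _ _ => c). Qed.

Lemma step_fun2_lin c s s' : step_fun2 s -> step_fun2 s' ->
  step_fun2 (fun x => c * s x + s' x).
Proof.
case=> n [a ->] [m [b ->]]; exists (n.+1 * m.+1).-1, (fun k l =>
  c * a (inord (k %/ m.+1)) (inord (l %/ m.+1)) +
  b (inord (k %/ n.+1)) (inord (l %/ n.+1))).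
by apply/funext => x; rewrite -!cell_refine -!cell_refine2.
Qed.

Lemma step_fun2_prod s s' : step_fun1 s -> step_fun1 s' ->
  step_fun2 (fun z => s z.1 * s' z.2).
Proof.
case=> n [a ->] [m [b ->]]; exists (n.+1 * m.+1).-1, (fun k l =>
  a (inord (k %/ m.+1)) * b (inord (l %/ n.+1))).
by apply/funext => x; rewrite -cell_refine -cell_refine2.
Qed.

Lemma bounded_measurable_cell2 n (a : 'I_n.+1 -> 'I_n.+1 -> R) :
  bounded_measurable (fun z : I * I => a (cell n z.1) (cell n z.2)).
Proof.
pose delta i (x : I) : R := (cell n x == i)%:R.
have -> : (fun z : I * I => a (cell n z.1) (cell n z.2)) =
    (fun z => \sum_i delta i z.1 * a i (cell n z.2)).
  apply/funext => z; rewrite (bigD1 (cell n z.1))//= /delta eqxx mul1r.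
  rewrite big1 ?addr0// => i /negbTE iz.
  by rewrite eq_sym iz mul0r.
apply: bounded_measurable_sum => i; apply: bounded_measurableM.
  apply: (bounded_measurable_comp (h := fst)); first exact: measurable_fst.
  exact: (bounded_measurable_cell (fun j => (j == i)%:R)).
apply: (bounded_measurable_comp (h := snd) (F := fun x => a i (cell n x))).
  exact: measurable_snd.
exact: bounded_measurable_cell.
Qed.

Lemma step_fun2_bounded s : step_fun2 s -> bounded_measurable s.
Proof. by case=> n [a ->]; exact: bounded_measurable_cell2. Qed.

(** The indicator of a ray is constant on every cell but the one that contains
    [c], of mass 1/(n+1). *)
Lemma step_fun1_ray (c : R) : L1_approximable U step_fun1 (\1_(`]-oo, c[%classic)).
Proof.
move=> e e0; pose n := Num.truncn e^-1.
have ne : n.+1%:R^-1 < e.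
  by rewrite invf_plt ?posrE ?ltr0n//; exact: Num.Theory.truncnS_gt.
(* The value on a cell is that of the indicator at its left endpoint. *)
pose a (i : 'I_n.+1) : R := (i%:R / n.+1%:R < c)%R%:R.
exists (fun x => a (cell n x)); first by exists n, a.
pose b (i : 'I_n.+1) : R := (in_cell i c)%:R.
have mray : measurable (`]-oo, c[%classic : set I) by exact: measurable_itv.
apply: (@le_lt_trans _ _ (\int[U]_x b (cell n x))).
  apply: le_mean_unif01; last first.
  - move=> x /(in_cell_cell n); rewrite /a /b indicE.
    have -> : (x \in `]-oo, c[%classic) = (x < c).
      by apply/idP/idP; rewrite inE /= in_itv.
    move: (cell n x) => i; rewrite /in_cell => /andP[ix xi].
    have [xc|cx] := ltP x c; first by rewrite (le_lt_trans ix xc) subrr normr0.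
    have [ic|_] := ltP; last by rewrite subrr normr0.
    by rewrite (ltW ic) (le_lt_trans cx xi) sub0r normrN1.
  - exact: bounded_measurable_cell.
  - apply/bounded_measurable_norm/bounded_measurableB.
      exact: bounded_measurable_indic.
    exact: bounded_measurable_cell.
rewrite mean_cell; apply: le_lt_trans ne.
rewrite -[leRHS]mulr1 ler_wpM2l ?invr_ge0//.
have [[i ic]|nc] := pselect (exists i : 'I_n.+1, in_cell i c); last first.
  rewrite big1// => i _; rewrite /b.
  by case: (boolP (in_cell _ _)) => // ic; case: nc; exists i.
rewrite (bigD1 i)//= big1 ?addr0 ?/b ?ic// => j ji.
by case: (boolP (in_cell _ _)) => // /(in_cell_inj ic) ij; rewrite ij eqxx in ji.
Qed.

Lemma step_fun1_dense F : bounded_measurable F -> L1_approximable U step_fun1 F.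
Proof.
apply: (@L1_density _ _ _ U _ step_fun1_bounded step_fun1_cst step_fun1_lin
  (@RGenInftyO.G R)).
- exact: RGenInftyO.measurableE.
- move=> _ _ [x ->] [y ->]; exists (Num.min x y).
  by apply/seteqP; split => z /=; rewrite !in_itv /= lt_min => /andP.
- by move=> _ [c ->]; exact: step_fun1_ray.
Qed.

Lemma mean_fst (F : I -> R) : bounded_measurable F ->
  \int[(U \x U)%E]_z F z.1 = \int[U]_x F x.
Proof.
move=> bF; rewrite mean_prod /=.
  by apply: eq_Rintegral => x _; rewrite mean_cst.
by apply: bounded_measurable_comp => //; exact: measurable_fst.
Qed.

Lemma mean_snd (F : I -> R) : bounded_measurable F ->
  \int[(U \x U)%E]_z F z.2 = \int[U]_x F x.
Proof.
move=> bF; rewrite mean_prod /=; first by rewrite mean_cst.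
by apply: bounded_measurable_comp => //; exact: measurable_snd.
Qed.

Lemma step_fun2_rect (A B : set I) : measurable A -> measurable B ->
  L1_approximable (U \x U)%E step_fun2 (\1_(A `*` B)).
Proof.
move=> mA mB e e0; have h0 : 0 < e / 2 by rewrite divr_gt0.
have bA := bounded_measurable_indic R mA; have bB := bounded_measurable_indic R mB.
have [s Ss As] := step_fun1_dense bA h0.
have bs := step_fun1_bounded Ss; have [_ [M sM]] := bs.
have M0 : 0 <= M := le_trans (normr_ge0 _) (sM 0).
have d0 : 0 < e / 2 / (M + 1) by rewrite divr_gt0// ltr_wpDl.
have [s' Ss' Bs'] := step_fun1_dense bB d0; have bs' := step_fun1_bounded Ss'.
exists (fun z => s z.1 * s' z.2); first exact: step_fun2_prod.
have bAs := bounded_measurable_norm (bounded_measurableB bA bs).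
have bBs := bounded_measurable_norm (bounded_measurableB bB bs').
have mfst : measurable_fun setT (fst : I * I -> I) by exact: measurable_fst.
have msnd : measurable_fun setT (snd : I * I -> I) by exact: measurable_snd.
have bAs1 := bounded_measurable_comp mfst bAs.
have bBs2 := bounded_measurable_comp msnd bBs.
apply: (@le_lt_trans _ _ (\int[(U \x U)%E]_z
   (`|\1_A z.1 - s z.1| + M * `|\1_B z.2 - s' z.2|))).
  apply: le_mean.
  - apply/bounded_measurable_norm/bounded_measurableB.
      by apply: bounded_measurable_indic; exact: measurableX.
    apply: bounded_measurableM; first exact: (bounded_measurable_comp mfst bs).
    exact: (bounded_measurable_comp msnd bs').
  - by apply: bounded_measurableD => //; exact: bounded_measurableZ.
  - move=> [x y] /=.
    have -> : \1_(A `*` B) (x, y) = \1_A x * \1_B y :> R.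
      by rewrite !indicE in_setX /=; case: (_ \in A); case: (_ \in B);
        rewrite ?mulr0 ?mul0r ?mulr1.
    have -> : \1_A x * \1_B y - s x * s' y =
        (\1_A x - s x) * \1_B y + s x * (\1_B y - s' y) by ring.
    apply: le_trans (ler_normD _ _) _; rewrite !normrM lerD//.
      rewrite ler_piMr// indicE; case: (_ \in B); rewrite ?normr1 ?normr0//.
    by rewrite ler_wpM2r.
rewrite meanD//; last exact: bounded_measurableZ.
rewrite meanZ// (mean_fst bAs) (mean_snd bBs) [e]splitr ltr_leD//.
apply: (@le_trans _ _ ((M + 1) * \int[U]_x `|\1_B x - s' x|)).
  by rewrite ler_wpM2r// ?lerDl//; apply: Rintegral_ge0.
by rewrite mulrC -ler_pdivlMr ?ltW// ltr_wpDl.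
Qed.

Lemma step_fun2_dense F : bounded_measurable F ->
  L1_approximable (U \x U)%E step_fun2 F.
Proof.
apply: (@L1_density _ _ _ (U \x U)%E _ step_fun2_bounded step_fun2_cst step_fun2_lin
  [set A `*` B | A in measurable & B in measurable]).
- exact: measurable_prod_measurableType.
- move=> _ _ [A mA [B mB <-]] [C mC [D mD <-]].
  by exists (A `&` C); [exact: measurableI|exists (B `&` D);
    [exact: measurableI|rewrite setXI]].
- by move=> _ [A mA [B mB <-]]; exact: step_fun2_rect.
Qed.

Definition clip (a b x : R) := Num.max a (Num.min b x).

Lemma clip_itv a b x : a <= b -> a <= clip a b x <= b.
Proof. by move=> ab; rewrite /clip le_max lexx ge_max ab ge_min lexx. Qed.

Lemma clip_near a b x y : a <= y <= b -> `|y - clip a b x| <= `|y - x|.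
Proof.
move=> /andP[ay yb]; have h1 := ler_norm (y - x).
have h2 := ler_norm (- (y - x)); rewrite normrN in h2.
by rewrite /clip ler_norml; case: (leP b x) => bx;
  [case: (leP a b) => ab|case: (leP a x) => ax]; apply/andP; split; lra.
Qed.

(** Clipping to [a,b] is 1-Lipschitz and symmetrisation is an average, so
    neither increases the L1 distance to a symmetric function with values in
    [a,b]. *)
Lemma step_graphon_approx (a b : R) (g : I * I -> R) (e : R) :
  a <= b -> bounded_measurable g -> (forall z, a <= g z <= b) ->
  (forall x y, g (x, y) = g (y, x)) -> 0 < e ->
  exists n (w : 'I_n.+1 -> 'I_n.+1 -> R), [/\ forall i j, w i j = w j i,
    forall i j, a <= w i j <= b &
    \int[(U \x U)%E]_z `|g z - w (cell n z.1) (cell n z.2)| < e].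
Proof.
move=> ab bg gab gsym e0; have [s Ss gs] := step_fun2_dense bg e0.
have bs := step_fun2_bounded Ss; have [n [v sv]] := Ss.
pose c i j := clip a b (v i j).
exists n, (fun i j => (c i j + c j i) / 2); split.
- by move=> i j; rewrite addrC.
- move=> i j; have := clip_itv (v i j) ab; have := clip_itv (v j i) ab.
  by rewrite /c => /andP[? ?] /andP[? ?]; apply/andP; split; lra.
have bgs := bounded_measurable_norm (bounded_measurableB bg bs).
have bsw : bounded_measurable (fun z : I * I => `|g (z.2, z.1) - s (z.2, z.1)|).
  apply: (bounded_measurable_comp (h := fun z : I * I => (z.2, z.1))) bgs.
  exact: measurable_swap.
apply: (@le_lt_trans _ _ (\int[(U \x U)%E]_z
  (2^-1 * `|g z - s z| + 2^-1 * `|g (z.2, z.1) - s (z.2, z.1)|))).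
  apply: le_mean.
  - apply/bounded_measurable_norm/bounded_measurableB => //.
    exact: (bounded_measurable_cell2 (fun i j => (c i j + c j i) / 2)).
  - by apply: bounded_measurableD; exact: bounded_measurableZ.
  - move=> [x y] /=; have := clip_near (v (cell n x) (cell n y)) (gab (x, y)).
    have := clip_near (v (cell n y) (cell n x)) (gab (y, x)).
    rewrite sv /= -/(c _ _) -/(c _ _) => h1 h2.
    have -> : g (x, y) - (c (cell n x) (cell n y) + c (cell n y) (cell n x)) / 2 =
       2^-1 * (g (x, y) - c (cell n x) (cell n y)) +
       2^-1 * (g (y, x) - c (cell n y) (cell n x)).
      by rewrite (gsym y x); field.
    apply: le_trans (ler_normD _ _) _; rewrite !normrM gtr0_norm ?invr_gt0//.
    by rewrite lerD// ler_wpM2l.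
rewrite meanD ?meanZ//; try exact: bounded_measurableZ.
suff -> : \int[(U \x U)%E]_z `|g (z.2, z.1) - s (z.2, z.1)| =
          \int[(U \x U)%E]_z `|g z - s z|.
  by rewrite -mulrDl; lra.
by rewrite (mean_prod U U bsw) (mean_prod U U bgs) (mean_swap U U bgs).
Qed.

End step_functions.

(** * The rate function as a Bregman divergence *)

Section rate_function.
Variable R : realType.
Implicit Types p q u v a b : R.

Lemma mul_ln_div a b : 0 <= a -> 0 < b -> a * ln (a / b) = a * (ln a - ln b).
Proof.
rewrite le_eqVlt => /predU1P[<-|a0] b0; first by rewrite !mul0r.
by rewrite ln_div.
Qed.

(** This is [ln x <= x - 1] at [x = sqrt (b / a)]; summed over two outcomes it
    bounds the relative entropy below by the squared Hellinger distance. *)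
Lemma mul_ln_hellinger a b : 0 <= a -> 0 < b ->
  2 * (a - Num.sqrt a * Num.sqrt b) <= a * ln (a / b).
Proof.
rewrite le_eqVlt => /predU1P[<-|a0] b0.
  by rewrite sqrtr0 !mul0r subrr mulr0.
set x := Num.sqrt a; set y := Num.sqrt b.
have x0 : 0 < x by rewrite sqrtr_gt0.
have y0 : 0 < y by rewrite sqrtr_gt0.
have aE : a = x ^+ 2 by rewrite sqr_sqrtr// ltW.
have bE : b = y ^+ 2 by rewrite sqr_sqrtr// ltW.
have -> : ln (a / b) = - (2 * ln (y / x)).
  by rewrite aE bE !ln_div ?posrE ?exprn_gt0// !lnXn//; ring.
have h : ln (y / x) <= y / x - 1.
  have -> : y / x = 1 + (y / x - 1) by rewrite addrC subrK.
  rewrite [1 + _ - 1]addrAC subrr add0r; apply: le_ln1Dx.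
  by rewrite ltrBDr addNr divr_gt0.
 rewrite aE mulrN -subr_ge0.
have -> : - (x ^+ 2 * (2 * ln (y / x))) - 2 * (x ^+ 2 - x * y) =
   2 * x ^+ 2 * (y / x - 1 - ln (y / x)) by field; rewrite gt_eqF.
by apply: mulr_ge0; [rewrite mulr_ge0 ?sqr_ge0|rewrite subr_ge0].
Qed.

(** A weak Pinsker inequality, through the Hellinger distance. *)
Lemma rate_ge_sqr q u : 0 < q < 1 -> 0 <= u <= 1 ->
  (u - q) ^+ 2 / 4 <= rate q u.
Proof.
move=> /andP[q0 q1] /andP[u0 u1].
have key a b : 0 <= a <= 1 -> 0 < b <= 1 ->
    (a - b) ^+ 2 / 4 + (a - b) <= a * ln (a / b).
  move=> /andP[a0 a1] /andP[b0 b1]; apply: le_trans (mul_ln_hellinger a0 b0).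
  have [x0 y0] : 0 <= Num.sqrt a /\ 0 <= Num.sqrt b by rewrite !sqrtr_ge0.
  have x1 : Num.sqrt a <= 1 by rewrite -sqrtr1 ler_sqrt.
  have y1 : Num.sqrt b <= 1 by rewrite -sqrtr1 ler_sqrt.
  have := sqr_sqrtr a0; have := sqr_sqrtr (ltW b0).
  move: (Num.sqrt a) (Num.sqrt b) x0 y0 x1 y1 => x y x0 y0 x1 y1 <- <-.
  have -> : (x ^+ 2 - y ^+ 2) ^+ 2 / 4 = (x - y) ^+ 2 * ((x + y) ^+ 2 / 4) by field.
  have : (x - y) ^+ 2 * ((x + y) ^+ 2 / 4) <= (x - y) ^+ 2.
    by rewrite ler_piMr ?sqr_ge0//; nra.
  by lra.
have h1 : (u - q) ^+ 2 / 4 + (u - q) <= u * ln (u / q).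
  by apply: key; apply/andP; split; lra.
have h2 : (1 - u - (1 - q)) ^+ 2 / 4 + (1 - u - (1 - q)) <=
    (1 - u) * ln ((1 - u) / (1 - q)).
  by apply: key; apply/andP; split; lra.
rewrite /rate.
have -> : (u - q) ^+ 2 / 4 = 2^-1 * ((u - q) ^+ 2 / 4 + (u - q) +
  ((1 - u - (1 - q)) ^+ 2 / 4 + (1 - u - (1 - q)))) by field.
by rewrite ler_pM2l ?invr_gt0// lerD.
Qed.

Lemma rate_ge0 q u : 0 < q < 1 -> 0 <= u <= 1 -> 0 <= rate q u.
Proof.
by move=> q01 u01; apply: le_trans (rate_ge_sqr q01 u01); rewrite divr_ge0 ?sqr_ge0.
Qed.

(** The derivative of [rate p] at [q]. *)
Definition rate_slope p q : R := 2^-1 * (ln (q / p) - ln ((1 - q) / (1 - p))).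

(** The Bregman divergence of the entropy is the relative entropy: the remainder
    of the tangent of [rate p] at [q] is exactly [rate q]. This identity gives
    convexity, the Lipschitz bound and the form of [tilted_rate] below. *)
Lemma rate_bregman p q u : 0 < p < 1 -> 0 < q < 1 -> 0 <= u <= 1 ->
  rate p u = rate p q + rate_slope p q * (u - q) + rate q u.
Proof.
move=> /andP[p0 p1] /andP[q0 q1] /andP[u0 u1]; rewrite /rate /rate_slope.
have [p1' q1'] : 0 < 1 - p /\ 0 < 1 - q by split; lra.
have [u1' q0w q1w] : [/\ 0 <= 1 - u, 0 <= q & 0 <= 1 - q] by split; lra.
by rewrite !mul_ln_div// !ln_div ?posrE//; field.
Qed.

Lemma rate_tangent p q u : 0 < p < 1 -> 0 < q < 1 -> 0 <= u <= 1 ->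
  rate p q + rate_slope p q * (u - q) <= rate p u.
Proof.
by move=> p01 q01 u01; rewrite (rate_bregman p01 q01 u01) lerDl rate_ge0.
Qed.

Lemma rate_slope_gt0 p q : 0 < p -> p < q -> q < 1 -> 0 < rate_slope p q.
Proof.
move=> p0 pq q1; rewrite /rate_slope mulr_gt0 ?invr_gt0// subr_gt0.
rewrite ltr_ln ?posrE ?divr_gt0//; try lra.
by apply: (@lt_trans _ _ 1); rewrite ?ltr_pdivrMr ?ltr_pdivlMr; lra.
Qed.

Lemma rate_ub p u : 0 < p < 1 -> 0 <= u <= 1 ->
  rate p u <= 2^-1 * (- ln p - ln (1 - p)).
Proof.
move=> /andP[p0 p1] /andP[u0 u1]; rewrite /rate ler_pM2l ?invr_gt0//.
rewrite !mul_ln_div; try lra.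
have lp : ln p <= 0 by rewrite ln_le0// ltW.
have lp' : ln (1 - p) <= 0 by apply: ln_le0; lra.
have lu : ln u <= 0 by rewrite ln_le0.
have lu' : ln (1 - u) <= 0 by apply: ln_le0; lra.
by nra.
Qed.

(** Averaging the tangent inequality at the mixture [l * u + m * 1 +
    (1 - l - m) * 0], which lies in the open interval where tangents exist. *)
Lemma rate_convex p u (l m : R) : 0 < p < 1 -> 0 <= u <= 1 ->
  0 <= l -> 0 < m -> l + m < 1 ->
  rate p (l * u + m) <= l * rate p u + m * rate p 1 + (1 - l - m) * rate p 0.
Proof.
move=> p01 u01 l0 m0 lm1; have /andP[u0 u1] := u01.
have v01 : 0 < l * u + m < 1 by apply/andP; split; nra.
have h1 := rate_tangent p01 v01 u01.
have [in0 in1] : 0 <= (0 : R) <= 1 /\ 0 <= (1 : R) <= 1.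
  by rewrite !lexx !ler01.
have h2 := rate_tangent p01 v01 in1.
have h3 := rate_tangent p01 v01 in0.
have r0 : 0 <= 1 - l - m by lra.
move: (rate p _) (rate_slope p _) h1 h2 h3 => r s h1 h2 h3.
have h1' := ler_wpM2l l0 h1; have h2' := ler_wpM2l (ltW m0) h2.
have h3' := ler_wpM2l r0 h3.
apply: le_trans (lerD (lerD h1' h2') h3').
by rewrite le_eqVlt; apply/orP; left; apply/eqP; ring.
Qed.

(** The slope of [rate p] blows up only at 0 and 1. *)
Lemma rate_lipschitz p a u v : 0 < p < 1 -> 0 < a ->
  a <= u <= 1 - a -> a <= v <= 1 - a ->
  rate p u - rate p v <= (- ln a - ln p - ln (1 - p)) * `|u - v|.
Proof.
move=> p01 a0 uI vI; have [p0 p1] := andP p01.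
have [/andP[au ua] /andP[av va]] := (uI, vI).
have h : rate p u + rate_slope p u * (v - u) <= rate p v.
  by apply: rate_tangent => //; apply/andP; split; lra.
apply: (@le_trans _ _ (`|rate_slope p u| * `|u - v|)).
  by rewrite -normrM; apply: le_trans (ler_norm _); nra.
rewrite ler_wpM2r// /rate_slope !ln_div ?posrE; try lra.
have lu : ln a <= ln u by rewrite ler_ln ?posrE//; lra.
have lu' : ln a <= ln (1 - u) by rewrite ler_ln ?posrE//; lra.
have lu1 : ln u <= 0 by apply: ln_le0; lra.
have lu1' : ln (1 - u) <= 0 by apply: ln_le0; lra.
have lp : ln p <= 0 by apply: ln_le0; lra.
have lp' : ln (1 - p) <= 0 by apply: ln_le0; lra.
by rewrite ler_norml; apply/andP; split; lra.
Qed.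

Lemma measurable_rate p : 0 < p < 1 -> measurable_fun [set: R] (rate p).
Proof.
move=> p01; apply: measurable_funM; first exact: measurable_cst.
have m1 (c : R) : measurable_fun [set: R] (fun u : R => u * ln (u / c)).
  apply: measurable_funM; first exact: measurable_id.
  apply: measurableT_comp; first exact: measurable_ln.
  apply: measurable_funM; [exact: measurable_id|exact: measurable_cst].
apply: measurable_funD; first exact: m1.
apply: (measurableT_comp (m1 (1 - p))).
apply: measurable_funB; [exact: measurable_cst|exact: measurable_id].
Qed.

(** The exponent of the second moment: on graphs that look like the constant [u],
    the squared likelihood ratio contributes [2 * rate q - 2 * rate p] and the
    sampling law [- rate q], for a total of [- tilted_rate p q]. *)
Definition tilted_rate p q u : R := 2 * rate p u - rate q u.

(** By the Bregman identity, [tilted_rate] is [rate p] plus an affine function;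
    in particular it is convex. *)
Lemma tilted_rateE p q u : 0 < p < 1 -> 0 < q < 1 -> 0 <= u <= 1 ->
  tilted_rate p q u = rate p u + rate p q + rate_slope p q * (u - q).
Proof.
move=> p01 q01 u01; rewrite /tilted_rate.
by have := rate_bregman p01 q01 u01; move: (rate_slope p q * _) => y ->; ring.
Qed.

Lemma tilted_rate_lipschitz p q a : 0 < p < 1 -> 0 < q < 1 -> 0 < a < 1 ->
  exists2 L : R, 0 <= L & forall u v, a <= u <= 1 - a -> a <= v <= 1 - a ->
    tilted_rate p q u <= tilted_rate p q v + L * `|v - u|.
Proof.
move=> p01 q01 /andP[a0 a1]; have [p0 p1] := andP p01.
exists (- ln a - ln p - ln (1 - p) + `|rate_slope p q|).
  have la : ln a <= 0 by apply: ln_le0; exact: ltW.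
  have lp : ln p <= 0 by apply: ln_le0; exact: ltW.
  have lp' : ln (1 - p) <= 0 by apply: ln_le0; rewrite gerBl ltW.
  by rewrite addr_ge0//; lra.
move=> u v uI vI; have := rate_lipschitz p01 a0 uI vI; rewrite distrC.
have : rate_slope p q * (u - v) <= `|rate_slope p q| * `|v - u|.
  by rewrite distrC -normrM ler_norm.
have in01 w : a <= w <= 1 - a -> 0 <= w <= 1.
  by move=> /andP[? ?]; apply/andP; split; lra.
rewrite !tilted_rateE ?in01// [X in _ -> _ -> _ <= _ + X]mulrDl.
move: (rate p u) (rate p v) (rate p q) (rate_slope p q) `|v - u|.
move: (- ln a - ln p - ln (1 - p)) => k x y z s d h1 h2.
have : s * (u - q) = s * (v - q) + s * (u - v) by ring.
by move: h1 h2; move: (s * _) (s * _) (s * _) (k * d) (`|s| * d) => *; lra.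
Qed.

End rate_function.

(** * Arithmetic of the perturbation towards the interior *)

Section perturbation_arithmetic.
Variable R : realType.
Implicit Types t e h x y z B c : R.

Lemma perturb_itv e h y : 0 < e -> e <= 2^-1 -> 0 < h -> h <= e / 24 ->
  0 <= y <= 1 -> h <= (1 - h) * ((1 - e) * y + e) <= 1 - h.
Proof.
move=> e0 e2 h0 he /andP[y0 y1].
have : e <= (1 - e) * y + e <= 1.
  have e1 : 0 <= 1 - e by lra.
  by rewrite lerDr mulr_ge0//= -lerBrDr ler_piMr.
move: ((1 - e) * y + e) => v /andP[ev v1].
have h1 : 0 <= 1 - h by lra.
have he1 : (1 - h) * e <= (1 - h) * v by rewrite ler_wpM2l.
have he2 : h * e <= h by rewrite ler_piMr ?ltW//; lra.
by rewrite ler_piMr// andbT; lra.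
Qed.

(** The difference expands into terms with nonnegative coefficients, because a
    product of numbers of [0,1] is at most each of its partial products. *)
Lemma perturb_product e h x y z : 0 <= e <= 1 -> 0 <= h <= 1 ->
  0 <= x <= 1 -> 0 <= y <= 1 -> 0 <= z <= 1 ->
  (1 - h) ^+ 3 * ((1 - e ^+ 3) * (x * y * z) + e ^+ 3) <=
  (1 - h) * ((1 - e) * x + e) * ((1 - h) * ((1 - e) * y + e)) *
  ((1 - h) * ((1 - e) * z + e)).
Proof.
move=> /andP[e0 e1] /andP[h0 h1] /andP[x0 x1] /andP[y0 y1] /andP[z0 z1].
rewrite -subr_ge0 [leRHS](_ : _ =
  (1 - h) ^+ 3 * ((1 - e) * e * ((1 - e) * (x * y * (1 - z) + y * z * (1 - x) +
    x * z * (1 - y)) + e * (x * (1 - y * z) + y * (1 - x * z) + z * (1 - x * y)))));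
  last by ring.
have [xc yc zc] : [/\ 0 <= 1 - x, 0 <= 1 - y & 0 <= 1 - z] by rewrite !subr_ge0.
have [ec hc] : 0 <= 1 - e /\ 0 <= 1 - h by rewrite !subr_ge0.
have yz : 0 <= 1 - y * z by rewrite subr_ge0 mulr_ile1.
have xz : 0 <= 1 - x * z by rewrite subr_ge0 mulr_ile1.
have xy : 0 <= 1 - x * y by rewrite subr_ge0 mulr_ile1.
by rewrite mulr_ge0 ?exprn_ge0// mulr_ge0 ?mulr_ge0// addr_ge0// mulr_ge0//
  !addr_ge0// !mulr_ge0.
Qed.

(** Mixing with weight [e] towards 1 raises the triangle density by order [e ^ 3],
    mixing with weight [h] towards 0 lowers it by order [h], and both move the
    rate by order [e + h]. Hence [e] is small with respect to the slack [c - B]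
    and [h] with respect to [e ^ 3]. *)
Lemma perturb_parameters t B c x1 x0 : 0 < t < 1 -> B < c ->
  exists e h, [/\ 0 < e, e <= 2^-1, 0 < h & h <= e / 24] /\
    (1 - h) * (1 - e) * B + ((1 - h) * e * x1 + h * x0) < c /\
    forall y, t ^+ 3 <= y -> t ^+ 3 < (1 - h) ^+ 3 * ((1 - e ^+ 3) * y + e ^+ 3).
Proof.
move=> /andP[t0 t1] Bc.
(* [K] bounds the change of rate per unit of mixing weight. *)
pose K := `|x1 - B| + `|x0 - B| + 1.
have K0 : 0 < K by rewrite ltr_wpDl.
pose e := Num.min 2^-1 ((c - B) / (4 * K)).
have e0 : 0 < e by rewrite lt_min invr_gt0 ltr0n divr_gt0 ?subr_gt0// mulr_gt0.
have e2 : e <= 2^-1 by rewrite ge_min lexx.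
have eK : e * K <= (c - B) / 4.
  rewrite -ler_pdivlMr//; apply: (@le_trans _ _ ((c - B) / (4 * K))).
    by rewrite ge_min lexx orbT.
  by rewrite invfM mulrA.
clearbody e.
have t31 : t ^+ 3 < 1 by rewrite exprn_ilt1// ltW.
have t30 : 0 < t ^+ 3 by rewrite exprn_gt0.
pose h := e ^+ 3 * (1 - t ^+ 3) / 6.
have e30 : 0 < e ^+ 3 by rewrite exprn_gt0.
have e3e : e ^+ 3 <= e / 4 by rewrite exprSr mulrC ler_pM2l// expr2; nra.
have h0 : 0 < h by rewrite divr_gt0// mulr_gt0// subr_gt0.
have he : h <= e / 24 by rewrite /h ler_pdivrMr//; nra.
have hE : h * 6 = e ^+ 3 * (1 - t ^+ 3) by rewrite /h divfK.
clearbody h; exists e, h; split=> //; split.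
- have hK : (1 - h) * e * (x1 - B) + h * (x0 - B) <= 2 * (e * K).
    have e1 : 0 <= (1 - h) * e <= e by apply/andP; split; nra.
    rewrite /K; have := ler_norm (x1 - B); have := ler_norm (x0 - B).
    have := normr_ge0 (x1 - B); have := normr_ge0 (x0 - B).
    move: (x1 - B) (x0 - B) `|x1 - B| `|x0 - B| ((1 - h) * e) e1.
    move=> d1 d0 n1 n0 m /andP[m0 me] n00 n10 dn0 dn1.
    have a1 : m * d1 <= e * n1.
      by apply: (@le_trans _ _ (m * n1)); [rewrite ler_wpM2l|rewrite ler_wpM2r].
    have a0 : h * d0 <= e * n0.
      apply: (@le_trans _ _ (h * n0)).
        by rewrite ler_wpM2l// ltW.
      rewrite ler_wpM2r//.
      by lra.
    have : 0 <= e * n1 /\ 0 <= e * n0 by rewrite !mulr_ge0// ltW.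
    by move=> [? ?]; rewrite !mulrDr mulr1; lra.
  have -> : (1 - h) * (1 - e) * B + ((1 - h) * e * x1 + h * x0) =
    B + ((1 - h) * e * (x1 - B) + h * (x0 - B)) by ring.
  by move: hK; move: (_ + h * _) => k; lra.
- move=> y ty; have h3 : 1 - 3 * h <= (1 - h) ^+ 3.
    rewrite -subr_ge0.
    have -> : (1 - h) ^+ 3 - (1 - 3 * h) = h ^+ 2 * (3 - h) by ring.
    by rewrite mulr_ge0 ?sqr_ge0//; lra.
  have e31 : 0 <= 1 - e ^+ 3 by lra.
  have := ler_wpM2l e31 ty; move: (_ * y) => y' yt.
  have yy : t ^+ 3 + 6 * h <= y' + e ^+ 3 by lra.
  apply: (@lt_le_trans _ _ ((1 - 3 * h) * (t ^+ 3 + 6 * h))); first by nra.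
  by apply: ler_pM => //; lra.
Qed.

End perturbation_arithmetic.

(** * Kernels on the unit square and their triangle density *)

(** A graphon defined on the whole plane, so that it is a bounded measurable
    function for any law on the plane. *)
Definition kernel (R : realType) (g : measurableTypeR R * measurableTypeR R -> R) :=
  [/\ measurable_fun setT g, forall x y, g (x, y) = g (y, x) &
      forall z, 0 <= g z <= 1].

Section kernels.
Variable R : realType.
Local Notation U := (@unif01 R).
Local Notation lambda := (@lebesgue_measure R).
Local Notation I := (measurableTypeR R).
Implicit Types g : I * I -> R.

Lemma kernel_bounded g : kernel g -> bounded_measurable g.
Proof.
by move=> [mg _ g01]; split => //; exists 1 => z; have /andP[? ?] := g01 z;
  rewrite ger0_norm.
Qed.

Definition triangle_integrand g (w : I * I * I) : R :=
  g (w.1.1, w.1.2) * g (w.1.2, w.2) * g (w.1.1, w.2).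

Definition triangle_mean g : R :=
  \int[((U \x U) \x U)%E]_w triangle_integrand g w.

Section coordinates.
Variable F : I * I -> R.
Hypothesis bF : bounded_measurable F.

Let m1 : measurable_fun setT (fun w : I * I * I => w.1.1).
Proof. exact: measurableT_comp. Qed.

Let m2 : measurable_fun setT (fun w : I * I * I => w.1.2).
Proof. exact: measurableT_comp. Qed.

Lemma bounded_measurable_12 :
  bounded_measurable (fun w : I * I * I => F (w.1.1, w.1.2)).
Proof. by apply: bounded_measurable_comp bF; exact: measurable_fun_pair. Qed.

Lemma bounded_measurable_23 :
  bounded_measurable (fun w : I * I * I => F (w.1.2, w.2)).
Proof. by apply: bounded_measurable_comp bF; exact: measurable_fun_pair. Qed.

Lemma bounded_measurable_13 :
  bounded_measurable (fun w : I * I * I => F (w.1.1, w.2)).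
Proof. by apply: bounded_measurable_comp bF; exact: measurable_fun_pair. Qed.

Lemma mean_12 : \int[((U \x U) \x U)%E]_w F (w.1.1, w.1.2) = \int[(U \x U)%E]_z F z.
Proof.
rewrite (mean_prod (U \x U)%E U bounded_measurable_12).
by apply: eq_Rintegral => -[x y] _ /=; rewrite mean_cst.
Qed.

Lemma mean_23 : \int[((U \x U) \x U)%E]_w F (w.1.2, w.2) = \int[(U \x U)%E]_z F z.
Proof.
rewrite (mean_prod (U \x U)%E U bounded_measurable_23) (mean_prod U U bF) /=.
exact: (mean_snd (bounded_measurable_mean U U bF)).
Qed.

Lemma mean_13 : \int[((U \x U) \x U)%E]_w F (w.1.1, w.2) = \int[(U \x U)%E]_z F z.
Proof.
rewrite (mean_prod (U \x U)%E U bounded_measurable_13) (mean_prod U U bF) /=.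
exact: (mean_fst (bounded_measurable_mean U U bF)).
Qed.

End coordinates.

Lemma bounded_measurable_triangle g : bounded_measurable g ->
  bounded_measurable (triangle_integrand g).
Proof.
move=> bg; apply: bounded_measurableM; last exact: bounded_measurable_13.
apply: bounded_measurableM; first exact: bounded_measurable_12.
exact: bounded_measurable_23.
Qed.

Lemma triangle_mean_iter g : bounded_measurable g -> triangle_mean g =
  \int[U]_x \int[U]_y \int[U]_z (g (x, y) * g (y, z) * g (x, z)).
Proof.
move=> /bounded_measurable_triangle bt; rewrite /triangle_mean mean_prod//.
by rewrite (mean_prod U U (bounded_measurable_mean (U \x U)%E U bt)).
Qed.

(** Telescoping the product of three factors in [0,1]; each of the three pairs of
    coordinates is distributed as a uniform point of the square. *)
Lemma triangle_mean_lipschitz g g' : kernel g -> kernel g' ->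
  triangle_mean g <= triangle_mean g' + 3 * \int[(U \x U)%E]_z `|g z - g' z|.
Proof.
move=> kg kg'; have bg := kernel_bounded kg; have bg' := kernel_bounded kg'.
have [_ _ g01] := kg; have [_ _ g01'] := kg'.
have bd := bounded_measurable_norm (bounded_measurableB bg bg').
have b12 := bounded_measurable_12 bd; have b23 := bounded_measurable_23 bd.
have b13 := bounded_measurable_13 bd.
have -> : 3 * \int[(U \x U)%E]_z `|g z - g' z| =
    \int[((U \x U) \x U)%E]_w (`|g (w.1.1, w.1.2) - g' (w.1.1, w.1.2)| +
     `|g (w.1.2, w.2) - g' (w.1.2, w.2)| + `|g (w.1.1, w.2) - g' (w.1.1, w.2)|).
  rewrite meanD//; last exact: bounded_measurableD.
  rewrite meanD// (mean_12 bd) (mean_23 bd) (mean_13 bd); ring.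
have bt := bounded_measurable_triangle bg.
have bt' := bounded_measurable_triangle bg'.
have bs := bounded_measurableD (bounded_measurableD b12 b23) b13.
rewrite /triangle_mean -meanD//; apply: le_mean => //.
  exact: bounded_measurableD.
move=> w; rewrite /triangle_integrand.
have := g01 (w.1.1, w.1.2); have := g01 (w.1.2, w.2); have := g01 (w.1.1, w.2).
have := g01' (w.1.1, w.1.2); have := g01' (w.1.2, w.2); have := g01' (w.1.1, w.2).
move: (g (w.1.1, w.1.2)) (g (w.1.2, w.2)) (g (w.1.1, w.2)) => a b c.
move: (g' (w.1.1, w.1.2)) (g' (w.1.2, w.2)) (g' (w.1.1, w.2)) => a' b' c'.
move=> /andP[c0' c1'] /andP[b0' b1'] /andP[a0' a1'].
move=> /andP[c0 c1] /andP[b0 b1] /andP[a0 a1].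
rewrite -lerBlDl.
have -> : a * b * c - a' * b' * c' =
  (a - a') * (b * c) + (b - b') * (a' * c) + (c - c') * (a' * b') by ring.
have key d e : 0 <= e <= 1 -> d * e <= `|d| :> R.
  move=> /andP[e0 e1]; apply: (@le_trans _ _ (`|d| * e)).
    by rewrite ler_wpM2r// ler_norm.
  by rewrite ler_piMr.
by apply: lerD; [apply: lerD|]; apply: key; rewrite mulr_ge0//= mulr_ile1.
Qed.

Lemma integral01_mean (F : I -> R) : bounded_measurable F -> (forall x, 0 <= F x) ->
  (\int[lambda]_(x in `[0%R, 1%R]) (F x)%:E)%E = (\int[U]_x F x)%:E.
Proof.
move=> bF F0; rewrite -mean_EFin// integral_unif01//.
by apply/measurable_EFinP; case: bF.
Qed.

(** The values of a graphon off the square are arbitrary; they are replaced by 0. *)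
Definition kernel_of (f : R * R -> R) : I * I -> R := f \_ (@unit_square R).

Lemma kernel_ofE f (x y : R) : 0 <= x <= 1 -> 0 <= y <= 1 ->
  kernel_of f (x, y) = f (x, y).
Proof.
by move=> x01 y01; rewrite /kernel_of patchE mem_set//; split => /=; rewrite in_itv.
Qed.

Lemma kernel_of_out f (x y : R) : ~~ ((0 <= x <= 1) && (0 <= y <= 1)) ->
  kernel_of f (x, y) = 0.
Proof.
move=> xy; rewrite /kernel_of patchE memNset//= => -[/=].
by rewrite !in_itv /= => x01 y01; rewrite x01 y01 in xy.
Qed.

Lemma kernel_of_graphon f : is_graphon f -> kernel (kernel_of f).
Proof.
move=> [mf fsym f01]; split.
- apply/(measurable_restrictT f) => //.
  by apply: measurableX; exact: measurable_itv.
- move=> x y; have [/andP[x01 y01]|] := boolP ((0 <= x <= 1) && (0 <= y <= 1)).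
    by rewrite !kernel_ofE// fsym.
  by move=> xy; rewrite !kernel_of_out// andbC.
- move=> [x y]; have [/andP[x01 y01]|] := boolP ((0 <= x <= 1) && (0 <= y <= 1)).
    by rewrite kernel_ofE// f01.
  by move=> xy; rewrite kernel_of_out// lexx ler01.
Qed.

Lemma kernel_graphon g : kernel g -> is_graphon g.
Proof.
move=> [mg gsym g01]; split; [exact: measurable_funTS|by move=> *|by move=> *].
Qed.

Let itv01 (x : R) : x \in `[0%R, 1%R]%classic -> 0 <= x <= 1.
Proof. by rewrite inE /= in_itv. Qed.

Lemma triangle_densityE f : is_graphon f ->
  triangle_density f = (triangle_mean (kernel_of f))%:E.
Proof.
move=> /kernel_of_graphon kg; have bg := kernel_bounded kg; have [_ _ g01] := kg.
rewrite triangle_mean_iter//.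
have bt := bounded_measurable_triangle bg.
have t0 w : 0 <= triangle_integrand (kernel_of f) w.
  have g0 z : 0 <= kernel_of f z by case/andP: (g01 z).
  by rewrite !mulr_ge0.
pose t1 z := \int[U]_u triangle_integrand (kernel_of f) (z, u).
have bt1 : bounded_measurable t1 := bounded_measurable_mean (U \x U)%E U bt.
have t10 z : 0 <= t1 z by apply: Rintegral_ge0.
pose t2 x := \int[U]_y t1 (x, y).
have bt2 : bounded_measurable t2 := bounded_measurable_mean U U bt1.
have t20 z : 0 <= t2 z by apply: Rintegral_ge0.
rewrite -[RHS](integral01_mean bt2 t20).
apply: eq_integral => x /itv01 x01.
rewrite -[RHS](integral01_mean (bounded_measurable_pair1 x bt1))//.
apply: eq_integral => y /itv01 y01.
rewrite -[RHS](integral01_mean (bounded_measurable_pair1 (x, y) bt))//.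
apply: eq_integral => z /itv01 z01.
by rewrite /triangle_integrand /= !kernel_ofE.
Qed.

Lemma bounded_measurable_rate p g : 0 < p < 1 -> kernel g ->
  bounded_measurable (fun z => rate p (g z)).
Proof.
move=> p01 [mg _ g01]; split.
  by apply: measurableT_comp mg; exact: measurable_rate.
exists (2^-1 * (- ln p - ln (1 - p))) => z.
by rewrite ger0_norm ?rate_ge0// rate_ub.
Qed.

Lemma graphon_rateE p f : 0 < p < 1 -> is_graphon f ->
  graphon_rate p f = (\int[(U \x U)%E]_z rate p (kernel_of f z))%:E.
Proof.
move=> p01 /kernel_of_graphon kg; have [_ _ g01] := kg.
have br := bounded_measurable_rate p01 kg.
have r0 z : 0 <= rate p (kernel_of f z) by apply: rate_ge0.
rewrite mean_prod//; have br1 := bounded_measurable_mean U U br.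
rewrite -[RHS](integral01_mean br1); last by move=> x; apply: Rintegral_ge0.
apply: eq_integral => x /itv01 x01.
rewrite -[RHS](integral01_mean (bounded_measurable_pair1 x br))//.
by apply: eq_integral => y /itv01 y01; rewrite kernel_ofE.
Qed.

Lemma kernel_step n (w : 'I_n.+1 -> 'I_n.+1 -> R) :
  (forall i j, w i j = w j i) -> (forall i j, 0 <= w i j <= 1) ->
  kernel (fun z => w (cell n z.1) (cell n z.2)).
Proof.
by move=> wsym w01; split => //; have [] := bounded_measurable_cell2 w.
Qed.

Lemma mean_step n (F : 'I_n.+1 -> 'I_n.+1 -> R) :
  \int[(U \x U)%E]_z F (cell n z.1) (cell n z.2) =
  n.+1%:R^-1 ^+ 2 * \sum_i \sum_j F i j.
Proof.
rewrite (mean_prod U U (bounded_measurable_cell2 F)) /=.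
under eq_Rintegral do rewrite mean_cell.
rewrite (mean_cell (fun i => n.+1%:R^-1 * \sum_j F i j)).
by rewrite -big_distrr /= mulrA expr2.
Qed.

(** The triangle density of the step function with value [w i j] on cell (i, j). *)
Definition triangle_avg n (w : 'I_n -> 'I_n -> R) : R :=
  n%:R^-1 ^+ 3 * \sum_i \sum_j \sum_l w i j * w j l * w i l.

Lemma mean_cell3 n (F : 'I_n.+1 -> 'I_n.+1 -> 'I_n.+1 -> R) :
  \int[U]_x \int[U]_y \int[U]_z F (cell n x) (cell n y) (cell n z) =
  n.+1%:R^-1 ^+ 3 * \sum_i \sum_j \sum_l F i j l.
Proof.
under eq_Rintegral do under eq_Rintegral do rewrite mean_cell.
under eq_Rintegral do rewrite (mean_cell (fun j => n.+1%:R^-1 * \sum_l F _ j l)).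
rewrite (mean_cell (fun i => n.+1%:R^-1 * \sum_j (n.+1%:R^-1 * \sum_l F i j l))).
rewrite -big_distrr /= !mulrA -mulrA; under eq_bigr do rewrite -big_distrr /=.
by rewrite -big_distrr /= !mulrA !exprS expr0 mulr1 !mulrA.
Qed.

Lemma triangle_mean_step n (w : 'I_n.+1 -> 'I_n.+1 -> R) :
  triangle_mean (fun z => w (cell n z.1) (cell n z.2)) = triangle_avg w.
Proof.
rewrite triangle_mean_iter; last exact: bounded_measurable_cell2.
exact: (mean_cell3 (fun i j l => w i j * w j l * w i l)).
Qed.

End kernels.

(** * A near-optimal graphon with a strict gap *)

Section gap.
Variable R : realType.
Local Notation U := (@unif01 R).
Local Notation lambda := (@lebesgue_measure R).
Local Notation I := (measurableTypeR R).
Implicit Types (g : I * I -> R) (p q t : R).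

Lemma integral01_cst (c : R) :
  (\int[lambda]_(x in `[0%R, 1%R]) c%:E)%E = c%:E.
Proof.
have lambda01 : lambda `[0%R, 1%R]%classic = 1%:E.
  by rewrite lebesgue_measure_itv /= lte01 oppr0 adde0.
transitivity (c%:E * lambda `[0%R, 1%R]%classic)%E; last by rewrite lambda01 mule1.
by apply: integral_cst; exact: measurable_itv.
Qed.

Lemma cst_upper_tail t : 0 <= t <= 1 -> upper_tail t (fun _ : R * R => t).
Proof.
move=> t01; split; first by split => //; exact: measurable_cst.
by rewrite /triangle_density !integral01_cst lee_fin !exprS expr0 mulr1 mulrA.
Qed.

Lemma graphon_rate_cst p t : graphon_rate p (fun _ : R * R => t) = (rate p t)%:E.
Proof. by rewrite /graphon_rate !integral01_cst. Qed.

(** The constant [t] is in the upper tail and the rate is nonnegative, so the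
    infimum is a real number, bounded by [rate p t]. *)
Lemma upper_tail_rate_inf p t : 0 < p < 1 -> 0 <= t <= 1 ->
  exists phi : R, [/\ ereal_inf (graphon_rate p @` upper_tail t) = phi%:E,
    phi <= rate p t &
    forall e, 0 < e -> exists g, [/\ kernel g, t ^+ 3 <= triangle_mean g &
      \int[(U \x U)%E]_z rate p (g z) < phi + e]].
Proof.
move=> p01 t01; set S := graphon_rate p @` upper_tail t.
have infle : (ereal_inf S <= (rate p t)%:E)%E.
  apply: ereal_inf_lbound; exists (fun=> t); first exact: cst_upper_tail.
  exact: graphon_rate_cst.
have inf0 : (0 <= ereal_inf S)%E.
  apply: le_ereal_inf_tmp => _ [f [gf _] <-]; rewrite graphon_rateE// lee_fin.
  have [_ _ g01] := kernel_of_graphon gf.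
  by apply: Rintegral_ge0 => z _; exact: rate_ge0.
have inffin : ereal_inf S \is a fin_num.
  by rewrite ge0_fin_numE// (le_lt_trans infle)// ltry.
exists (fine (ereal_inf S)); rewrite fineK//; split=> [//||e e0].
  by rewrite -lee_fin fineK.
have [_ [f [gf tf] <-]] := lb_ereal_inf_adherent e0 inffin.
rewrite graphon_rateE// -[ereal_inf S]fineK// -EFinD lte_fin => fe.
exists (kernel_of f); split=> //; first exact: kernel_of_graphon.
by move: tf; rewrite triangle_densityE// lee_fin.
Qed.

Lemma kernel_cst (c : R) : 0 <= c <= 1 -> kernel (fun=> c).
Proof. by move=> c01; split => //; exact: measurable_cst. Qed.

Lemma triangle_mean_cst (c : R) : triangle_mean (fun=> c) = c ^+ 3.
Proof.
by rewrite /triangle_mean mean_cst !exprS expr0 mulr1 mulrA.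
Qed.

(** A linearised Pinsker inequality: [d <= s + d ^ 2 / (4 s)] for every [s > 0]. *)
Lemma mean_dev_le_rate q g (s : R) : 0 < q < 1 -> kernel g -> 0 < s ->
  \int[(U \x U)%E]_z `|g z - q| <= s + s^-1 * \int[(U \x U)%E]_z rate q (g z).
Proof.
move=> q01 kg s0; have bg := kernel_bounded kg; have [_ _ g01] := kg.
have br := bounded_measurable_rate q01 kg.
rewrite -meanZ// -{1}(mean_cst (U \x U)%E s) -meanD; last 2 first.
- exact: bounded_measurable_cst.
- exact: bounded_measurableZ.
apply: le_mean.
- exact/bounded_measurable_norm/bounded_measurableB/bounded_measurable_cst.
- apply: bounded_measurableD; first exact: bounded_measurable_cst.
  exact: bounded_measurableZ.
move=> z; have := rate_ge_sqr q01 (g01 z).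
rewrite -[(_ - _) ^+ 2]real_normK ?num_real//.
move: `|g z - q| (rate q (g z)) => d r dr.
apply: (@le_trans _ _ (s + s^-1 * (d ^+ 2 / 4))); last first.
  by rewrite lerD2l ler_pM2l ?invr_gt0.
rewrite -subr_ge0.
have -> : s + s^-1 * (d ^+ 2 / 4) - d = s^-1 * (d / 2 - s) ^+ 2.
  by field; rewrite gt_eqF.
by rewrite mulr_ge0 ?sqr_ge0// invr_ge0 ltW.
Qed.

Lemma bounded_measurable_tilted_rate p q g : 0 < p < 1 -> 0 < q < 1 -> kernel g ->
  bounded_measurable (fun z => tilted_rate p q (g z)).
Proof.
move=> p01 q01 kg; apply: bounded_measurableB; last exact: bounded_measurable_rate.
exact/bounded_measurableZ/bounded_measurable_rate.
Qed.

Lemma mean_tilted_rate p q g : 0 < p < 1 -> 0 < q < 1 -> kernel g ->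
  \int[(U \x U)%E]_z tilted_rate p q (g z) =
  2 * \int[(U \x U)%E]_z rate p (g z) - \int[(U \x U)%E]_z rate q (g z).
Proof.
move=> p01 q01 kg.
have bp := bounded_measurable_rate p01 kg; have bq := bounded_measurable_rate q01 kg.
have b2 := bounded_measurableZ 2 bp.
by rewrite /tilted_rate (meanB _ b2 bq) (meanZ _ _ bp).
Qed.

(** A graphon with small [rate q] is close to the constant [q] in L1. If [q < t],
    its triangle density is then below [t ^ 3]. If [t < q], its [rate p] is
    close to [rate p q], which exceeds [rate p t] and hence the infimum. Neither
    happens for a near-minimiser of [rate p] in the upper tail. *)
Lemma near_minimiser_rate_lb p q t phi : 0 < p < 1 -> 0 < q < 1 -> p < t -> t <= 1 ->
  q <> t -> phi <= rate p t ->
  exists e s : R, [/\ 0 < e, 0 < s &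
    forall g, kernel g -> t ^+ 3 <= triangle_mean g ->
    \int[(U \x U)%E]_z rate p (g z) < phi + e ->
    s <= \int[(U \x U)%E]_z rate q (g z)].
Proof.
move=> p01 q01 pt t1 qt phit; have [p0 p1] := andP p01; have [q0 q1] := andP q01.
case: (ltgtP q t) qt => // [qt _|tq _].
(* [s] is chosen so that an L1 distance below [2 * s] to the constant [q]
   keeps the triangle density below [q ^ 3 + 6 * s = t ^ 3]. *)
- have c0 : 0 < t ^+ 3 - q ^+ 3 by rewrite subr_gt0 ltrXn2r// ltW// (lt_trans p0).
  pose s := (t ^+ 3 - q ^+ 3) / 6; have s0 : 0 < s by rewrite divr_gt0.
  exists 1, (s ^+ 2); split=> //; first exact: exprn_gt0.
  move=> g kg tg _; rewrite leNgt; apply/negP => Ds.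
  have kq : kernel (fun _ : I * I => q) by apply: kernel_cst; rewrite !ltW.
  have := triangle_mean_lipschitz kg kq; rewrite triangle_mean_cst.
  have := mean_dev_le_rate q01 kg s0.
  have : s^-1 * \int[(U \x U)%E]_z rate q (g z) < s.
    by rewrite mulrC ltr_pdivrMr// -expr2.
  move: (s^-1 * _) (\int[_]_z `|_ - _|) => x y h1 h2 h3.
  have sE : s * 6 = t ^+ 3 - q ^+ 3 by rewrite /s divfK.
  by lra.
- have t0 := lt_trans p0 pt; have t01 : 0 < t < 1 by rewrite t0 (lt_trans tq).
  have q01' : 0 <= q <= 1 by rewrite !ltW.
  have gap0 : 0 < rate p q - rate p t.
    rewrite (rate_bregman p01 t01 q01') subr_gt0 -addrA ltrDl.
    have := rate_slope_gt0 p0 pt (lt_trans tq q1); have := rate_ge0 t01 q01'.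
    by move: (rate t q) (rate_slope p t) => x y; nra.
  have r0 := rate_slope_gt0 p0 (lt_trans pt tq) q1.
  (* An L1 distance below [2 * s] moves the tangent by at most half the gap. *)
  pose s := (rate p q - rate p t) / (4 * rate_slope p q).
  have s0 : 0 < s by rewrite divr_gt0// mulr_gt0.
  exists ((rate p q - rate p t) / 2), (s ^+ 2).
  split; [by rewrite divr_gt0|exact: exprn_gt0|move=> g kg tg ge].
  rewrite leNgt; apply/negP => Ds.
  have bg := kernel_bounded kg; have [_ _ g01] := kg.
  have bc := bounded_measurable_cst (I * I)%type q.
  have bgq := bounded_measurableB bg bc.
  have D0 : 0 <= \int[(U \x U)%E]_z rate q (g z).
    by apply: Rintegral_ge0 => z _; exact: rate_ge0.
  have := mean_dev_le_rate q01 kg s0.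
  have : s^-1 * \int[(U \x U)%E]_z rate q (g z) < s.
    by rewrite mulrC ltr_pdivrMr// -expr2.
  have : -1 * \int[(U \x U)%E]_z `|g z - q| <= \int[(U \x U)%E]_z (g z - q).
    rewrite -(meanZ _ (-1) (bounded_measurable_norm bgq)).
    apply: le_mean => //; first exact/bounded_measurableZ/bounded_measurable_norm.
    by move=> z; rewrite mulN1r lerNl -normrN ler_norm.
  have : \int[(U \x U)%E]_z rate p (g z) =
      rate p q + rate_slope p q * \int[(U \x U)%E]_z (g z - q) +
      \int[(U \x U)%E]_z rate q (g z).
    under eq_Rintegral do rewrite (rate_bregman p01 q01 (g01 _)).
    have br := bounded_measurable_rate q01 kg.
    have bz := bounded_measurableZ (rate_slope p q) bgq.
    have bcp := bounded_measurable_cst (I * I)%type (rate p q).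
    rewrite meanD//; last exact: bounded_measurableD.
    by rewrite meanD// mean_cst meanZ.
  move: ge D0; move: (\int[_]_z rate p _) (\int[_]_z rate q _) => A D ge D0 AE.
  move: (\int[_]_z (g z - q)) (\int[_]_z `|_|) AE => m d AE md Dx ds.
  have sE : s * rate_slope p q * 4 = rate p q - rate p t.
    by rewrite /s; field; rewrite gt_eqF.
  have : rate_slope p q * - (2 * s) <= rate_slope p q * m.
    by rewrite ler_pM2l//; lra.
  by move: AE; move: (rate_slope p q * m) => rm; lra.
Qed.

(** For a near-minimiser, subtracting [rate q], which stays bounded below, beats
    the error made in the infimum. *)
Lemma tilted_rate_gap p q t phi : 0 < p < 1 -> 0 < q < 1 -> p < t -> t <= 1 ->
  q <> t -> phi <= rate p t ->
  (forall e, 0 < e -> exists g, [/\ kernel g, t ^+ 3 <= triangle_mean g &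
      \int[(U \x U)%E]_z rate p (g z) < phi + e]) ->
  exists g, [/\ kernel g, t ^+ 3 <= triangle_mean g &
    \int[(U \x U)%E]_z tilted_rate p q (g z) < 2 * phi].
Proof.
move=> p01 q01 pt t1 qt phit near.
have [e [s [e0 s0 H]]] := near_minimiser_rate_lb p01 q01 pt t1 qt phit.
have min0 : 0 < Num.min e (s / 2) by rewrite lt_min e0 divr_gt0.
have [g [kg tg ge]] := near _ min0.
exists g; split => //; rewrite mean_tilted_rate//.
have := H g kg tg.
have [m1 m2] : Num.min e (s / 2) <= e /\ Num.min e (s / 2) <= s / 2.
  by rewrite !ge_min !lexx orbT.
move: ge m1 m2; move: (Num.min _ _) (\int[_]_z rate p _) (\int[_]_z rate q _).
move=> m A D Am me ms DA; have Ae : A < phi + e by lra.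
by have := DA Ae; lra.
Qed.

Lemma tilted_rate_convex p q u (l m : R) : 0 < p < 1 -> 0 < q < 1 -> 0 <= u <= 1 ->
  0 <= l -> 0 < m -> l + m < 1 ->
  tilted_rate p q (l * u + m) <=
  l * tilted_rate p q u + m * tilted_rate p q 1 + (1 - l - m) * tilted_rate p q 0.
Proof.
move=> p01 q01 u01 l0 m0 lm; have := rate_convex p01 u01 l0 m0 lm.
have [/andP[u0 u1]] := u01.
rewrite !tilted_rateE// ?ler01 ?lexx//; last by apply/andP; split; nra.
move: (rate p _) (rate p u) (rate p 1) (rate p 0) (rate p q) (rate_slope p q).
move=> a b c d e f h; rewrite -subr_ge0; rewrite -subr_ge0 in h.
by apply: le_trans h _; rewrite le_eqVlt; apply/orP; left; apply/eqP; ring.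
Qed.

(** Mixing with the constants 1 and 0 makes the triangle constraint strict and
    keeps the values away from 0 and 1, at an arbitrarily small cost in rate.
    It is here that [t < 1] is needed. *)
Lemma interior_perturbation p q t c g : 0 < p < 1 -> 0 < q < 1 -> 0 < t < 1 ->
  kernel g -> t ^+ 3 <= triangle_mean g ->
  \int[(U \x U)%E]_z tilted_rate p q (g z) < c ->
  exists a g', [/\ 0 < a, a <= 1 - a, kernel g', forall z, a <= g' z <= 1 - a &
    t ^+ 3 < triangle_mean g' /\ \int[(U \x U)%E]_z tilted_rate p q (g' z) < c].
Proof.
move=> p01 q01 t01 kg tg Bc.
have [mg gsym g01] := kg; have bg := kernel_bounded kg.
have [e [h [[e0 e2 h0 he] [Jc te]]]] :=
  perturb_parameters (tilted_rate p q 1) (tilted_rate p q 0) t01 Bc.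
have [e1 h1] : e < 1 /\ h < 1 by clear - e2 he; split; lra.
pose g' z := (1 - h) * ((1 - e) * g z + e).
have g'I z : h <= g' z <= 1 - h by apply: perturb_itv.
have kg' : kernel g'.
  split.
  - apply: measurable_funM; first exact: measurable_cst.
    apply: measurable_funD; last exact: measurable_cst.
    by apply: measurable_funM => //; exact: measurable_cst.
  - by move=> x y; rewrite /g' gsym.
  - move=> z; have /andP[hz zh] := g'I z.
    by rewrite (le_trans (ltW h0))// (le_trans zh)// gerBl ltW.
exists h, g'; split => //; first by clear - e2 he; lra.
have bt := bounded_measurable_triangle bg.
have bt' := bounded_measurable_triangle (kernel_bounded kg').
split.
- apply: lt_le_trans (te _ tg) _; rewrite /triangle_mean.
  have bz := bounded_measurableZ (1 - e ^+ 3) bt.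
  have bc := bounded_measurable_cst (I * I * I)%type (e ^+ 3).
  have -> : (1 - e ^+ 3) * \int[((U \x U) \x U)%E]_w triangle_integrand g w +
      e ^+ 3 = \int[((U \x U) \x U)%E]_w
      ((1 - e ^+ 3) * triangle_integrand g w + e ^+ 3).
    by rewrite (meanD _ bz bc) (meanZ _ _ bt) mean_cst.
  rewrite -(meanZ _ _ (bounded_measurableD bz bc)).
  apply: le_mean => //; first exact/bounded_measurableZ/bounded_measurableD.
  by move=> w; apply: perturb_product; rewrite ?g01// ltW//= ltW.
- have bJ k := @bounded_measurable_tilted_rate p q k p01 q01.
  apply: le_lt_trans Jc.
  have bz := bounded_measurableZ ((1 - h) * (1 - e)) (bJ _ kg).
  have bc := bounded_measurable_cst (I * I)%type
    ((1 - h) * e * tilted_rate p q 1 + h * tilted_rate p q 0).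
  rewrite -(meanZ _ _ (bJ _ kg)) -{1}(mean_cst (U \x U)%E
    ((1 - h) * e * tilted_rate p q 1 + h * tilted_rate p q 0)).
  rewrite -(meanD _ bz bc); apply: le_mean; [exact: bJ|exact: bounded_measurableD|].
  move=> z; have -> : g' z = (1 - h) * (1 - e) * g z + (1 - h) * e.
    by rewrite /g' mulrDr mulrA.
  have [h1' e1'] : 0 < 1 - h /\ 0 < 1 - e by rewrite !subr_gt0.
  have l0 : 0 <= (1 - h) * (1 - e) by rewrite mulr_ge0// ltW.
  have m0 : 0 < (1 - h) * e by rewrite mulr_gt0.
  have lm1 : (1 - h) * (1 - e) + (1 - h) * e < 1.
    by rewrite -mulrDr subrK mulr1 gtrBl.
  have := tilted_rate_convex p01 q01 (g01 z) l0 m0 lm1.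
  have -> : 1 - (1 - h) * (1 - e) - (1 - h) * e = h by ring.
  by rewrite addrA.
Qed.

(** The triangle density and the tilted rate are both Lipschitz for the L1
    distance among kernels with values in [a, 1 - a], so a step function close
    to the perturbed graphon inherits both strict inequalities. *)
Lemma step_matrix_gap p q t c g : 0 < p < 1 -> 0 < q < 1 -> 0 < t < 1 ->
  kernel g -> t ^+ 3 <= triangle_mean g ->
  \int[(U \x U)%E]_z tilted_rate p q (g z) < c ->
  exists (a : R) n (w : 'I_n.+1 -> 'I_n.+1 -> R),
    [/\ 0 < a, forall i j, w i j = w j i, forall i j, a <= w i j <= 1 - a,
    t ^+ 3 < triangle_avg w &
    n.+1%:R^-1 ^+ 2 * \sum_i \sum_j tilted_rate p q (w i j) < c].
Proof.
move=> p01 q01 t01 kg tg gc; have [q0 q1] := andP q01.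
have [a [g' [a0 a1 kg' g'I [tg' gc']]]] := interior_perturbation p01 q01 t01 kg tg gc.
have [mg' gsym' g01'] := kg'; have bg' := kernel_bounded kg'.
have a01 : 0 < a < 1 by rewrite a0; clear - a0 a1; lra.
have [L L0 JL] := tilted_rate_lipschitz p01 q01 a01.
set J' := \int[_]_z _ in gc'.
pose e := Num.min ((triangle_mean g' - t ^+ 3) / 4) ((c - J') / (L + 1)).
have L1 : 0 < L + 1 by rewrite ltr_wpDl.
have e0 : 0 < e by rewrite lt_min !divr_gt0// subr_gt0.
have eT : e <= (triangle_mean g' - t ^+ 3) / 4 by rewrite ge_min lexx.
have eJ : e * (L + 1) <= c - J' by rewrite -ler_pdivlMr// ge_min lexx orbT.
clearbody e; have [n [w [wsym wI we]]] := step_graphon_approx a1 bg' g'I gsym' e0.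
have kw : kernel (fun z => w (cell n z.1) (cell n z.2)).
  apply: kernel_step => // i j; have /andP[aw wa] := wI i j.
  by rewrite (le_trans (ltW a0))// (le_trans wa)// gerBl ltW.
exists a, n, w; split => //.
- have := triangle_mean_lipschitz kg' kw; rewrite triangle_mean_step.
  move: we eT; move: (\int[_]_z _) (triangle_mean _) (triangle_avg _) => y T T'.
  by clear - e0; lra.
- have bJ k := @bounded_measurable_tilted_rate p q k p01 q01.
  rewrite -(mean_step (fun i j => tilted_rate p q (w i j))).
  have bd := bounded_measurable_norm (bounded_measurableB bg' (kernel_bounded kw)).
  apply: (@le_lt_trans _ _ (J' + L * e)); last first.
    clearbody J'; move: eJ; rewrite mulrDr mulr1 [e * L]mulrC; move: (L * e) => Le.
    by clear - e0; lra.
  apply: (@le_trans _ _ (J' + L * \int[(U \x U)%E]_z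
      `|g' z - w (cell n z.1) (cell n z.2)|)); last first.
    by rewrite lerD2l ler_wpM2l// ltW.
  rewrite -(meanZ _ _ bd) -(meanD _ (bJ _ kg') (bounded_measurableZ L bd)).
  apply: le_mean; first exact: (bJ _ kw).
    by apply: bounded_measurableD; [exact: bJ|exact: bounded_measurableZ].
  by move=> z; apply: JL.
Qed.

End gap.

(** * Triangle density of a graph *)

Section graph_kernels.
Variable R : realType.
Local Notation U := (@unif01 R).
Local Notation I := (measurableTypeR R).

Lemma triangle_mean_eq (g g' : I * I -> R) :
  bounded_measurable g -> bounded_measurable g' ->
  (forall x y, 0 <= x < 1 -> 0 <= y < 1 -> g (x, y) = g' (x, y)) ->
  triangle_mean g = triangle_mean g'.
Proof.
move=> bg bg' gg'; rewrite (triangle_mean_iter bg) (triangle_mean_iter bg').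
have bt := bounded_measurable_triangle bg.
have bt' := bounded_measurable_triangle bg'.
have bt1 := bounded_measurable_mean (U \x U)%E U bt.
have bt1' := bounded_measurable_mean (U \x U)%E U bt'.
apply: eq_mean_unif01 => [||x x01]; [exact: (bounded_measurable_mean U U bt1)|
  exact: (bounded_measurable_mean U U bt1')|].
apply: eq_mean_unif01 => [||y y01]; [exact: (bounded_measurable_pair1 x bt1)|
  exact: (bounded_measurable_pair1 x bt1')|].
apply: eq_mean_unif01 => [||z z01]; [exact: (bounded_measurable_pair1 (x, y) bt)|
  exact: (bounded_measurable_pair1 (x, y) bt')|].
by rewrite !gg'.
Qed.

Lemma adj_sym n (X : graph n) i j : adj X i j = adj X j i.
Proof. by apply: eq_existsb => e; rewrite orbC. Qed.

Lemma graph_graphonE n (X : graph n.+1) (x y : R) : 0 <= x < 1 -> 0 <= y < 1 ->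
  graph_graphon X (x, y) = (adj X (cell n x) (cell n y))%:R :> R.
Proof.
move=> /(in_cell_cell n) cx /(in_cell_cell n) cy; congr (nat_of_bool _)%:R.
apply/existsP/idP => /= [[i /existsP[j /and3P[ix jy ij]]]|axy].
  by rewrite (cell_eq ix) (cell_eq jy).
by exists (cell n x); apply/existsP; exists (cell n y); rewrite cx cy.
Qed.

Lemma graph_graphon_out n (X : graph n.+1) (x y : R) :
  ~~ ((0 <= x < 1) && (0 <= y < 1)) -> graph_graphon X (x, y) = 0 :> R.
Proof.
move=> xy; rewrite /graph_graphon; case: existsP => //= -[i /existsP[j]].
by move=> /and3P[/in_cell_itv ix /in_cell_itv jy _]; rewrite ix jy in xy.
Qed.

Lemma graph_kernel n (X : graph n.+1) : kernel (graph_graphon X : I * I -> R).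
Proof.
split; last by move=> z; rewrite ler0n lern1 leq_b1.
- have m01 : measurable (`[0, 1[%classic `*` `[0, 1[%classic : set (I * I)).
    by apply: measurableX; exact: measurable_itv.
  have [+ _] : bounded_measurable (fun z : I * I =>
      (adj X (cell n z.1) (cell n z.2))%:R *
      \1_(`[0, 1[%classic `*` `[0, 1[%classic) z : R).
    apply: bounded_measurableM; last exact: bounded_measurable_indic.
    exact: (bounded_measurable_cell2 (fun i j => (adj X i j)%:R)).
  congr measurable_fun; apply/funext => -[x y] /=.
  have [/andP[x01 y01]|xy] := boolP ((0 <= x < 1) && (0 <= y < 1)).
    by rewrite graph_graphonE// indicE mem_set ?mulr1//=; split => /=; rewrite in_itv.
  rewrite graph_graphon_out// indicE memNset ?mulr0//= => -[/=].
  by rewrite !in_itv /= => x01 y01; rewrite x01 y01 in xy.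
- move=> x y; congr (nat_of_bool _)%:R => /=.
  apply/existsP/existsP => -[i /existsP[j /and3P[ix jy ij]]];
    by exists j; apply/existsP; exists i; rewrite ix jy adj_sym.
Qed.

Definition graph_triangle_avg n (X : graph n) : R :=
  triangle_avg (fun i j => (adj X i j)%:R).

Lemma graph_upper_tail n (X : graph n.+1) (t : R) :
  upper_tail t (graph_graphon X) <-> t ^+ 3 <= graph_triangle_avg X.
Proof.
have gX := kernel_graphon (graph_kernel X).
rewrite /upper_tail /= triangle_densityE//.
have -> : triangle_mean (kernel_of (graph_graphon X)) = graph_triangle_avg X.
  rewrite /graph_triangle_avg -triangle_mean_step; apply: triangle_mean_eq.
  - exact/kernel_bounded/kernel_of_graphon.
  - exact: (bounded_measurable_cell2 (fun i j => (adj X i j)%:R)).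
  have le01 (z : R) : 0 <= z < 1 -> 0 <= z <= 1 by move=> /andP[-> /ltW ->].
  by move=> x y x01 y01; rewrite kernel_ofE ?graph_graphonE ?le01.
by rewrite lee_fin; split => [[]|].
Qed.

End graph_kernels.

(** * Product Bernoulli laws *)

Section bernoulli_product.
Variables (R : realType) (P : finType).
Implicit Types (p : P -> R) (X : {ffun P -> bool}).

Definition bernoulli1 (r : R) (b : bool) : R := if b then r else 1 - r.

Definition bernoulli_prod p X : R := \prod_e bernoulli1 (p e) (X e).

(** The distributive law, i.e. independence of the coordinates. *)
Lemma bernoulli_prod_mean p (F : P -> bool -> R) :
  \sum_X bernoulli_prod p X * \prod_e F e (X e) =
  \prod_e (p e * F e true + (1 - p e) * F e false).
Proof.
transitivity (\prod_e \sum_b bernoulli1 (p e) b * F e b); last first.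
  by apply: eq_bigr => e _; rewrite big_bool.
rewrite bigA_distr_bigA; apply: eq_bigr => X _.
by rewrite -big_split.
Qed.

Lemma bernoulli_prod_sum p : \sum_X bernoulli_prod p X = 1.
Proof.
transitivity (\sum_X bernoulli_prod p X * \prod_(e : P) (1 : R)).
  by apply: eq_bigr => X _; rewrite big1_eq mulr1.
by rewrite (bernoulli_prod_mean p (fun _ _ => 1)) big1// => e _; ring.
Qed.

Lemma bernoulli_prod_gt0 p X : (forall e, 0 < p e < 1) -> 0 < bernoulli_prod p X.
Proof.
move=> p01; apply: prodr_gt0 => e _; have /andP[p0 p1] := p01 e.
by rewrite /bernoulli1; case: ifP; rewrite ?subr_gt0.
Qed.

Lemma bernoulli_prod_ge0 p X : (forall e, 0 <= p e <= 1) -> 0 <= bernoulli_prod p X.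
Proof.
move=> p01; apply: prodr_ge0 => e _; have /andP[p0 p1] := p01 e.
by rewrite /bernoulli1; case: ifP; rewrite ?subr_ge0.
Qed.

Lemma bernoulli_prod_all p (s : seq P) : uniq s ->
  \sum_X bernoulli_prod p X * (all X s)%:R = \prod_(e <- s) p e.
Proof.
move=> us; pose F e (b : bool) : R := if e \in s then b%:R else 1.
transitivity (\sum_X bernoulli_prod p X * \prod_e F e (X e)).
  apply: eq_bigr => X _; congr (_ * _); rewrite /F -big_mkcond /= -big_uniq//.
  by elim: s {us F} => [|e s IH]; rewrite ?big_nil//= big_cons -IH -natrM mulnb.
rewrite bernoulli_prod_mean [RHS]big_uniq//= [RHS]big_mkcond /=.
by apply: eq_bigr => e _; rewrite /F; case: ifP => _ /=; ring.
Qed.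

Lemma bernoulli_prod_coord p (h : P -> bool -> R) :
  \sum_X bernoulli_prod p X * (\sum_e h e (X e)) =
  \sum_e (p e * h e true + (1 - p e) * h e false).
Proof.
under eq_bigr do rewrite big_distrr /=.
rewrite exchange_big /=; apply: eq_bigr => e _.
pose F e' (b : bool) : R := if e' == e then h e b else 1.
transitivity (\sum_X bernoulli_prod p X * \prod_e' F e' (X e')).
  apply: eq_bigr => X _; congr (_ * _); rewrite (bigD1 e)//= /F eqxx big1 ?mulr1//.
  by move=> e' /negbTE ->.
rewrite bernoulli_prod_mean (bigD1 e)//= /F eqxx big1 ?mulr1// => e' /negbTE ->.
by ring.
Qed.

End bernoulli_product.

(** With [h = ln (q / (1 - q))], each edge multiplies the mass by [q / (1 - q)] and
    the partition function is [(1 - q) ^ - #|vpair n|]. *)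
Lemma edge_tilt_bernoulli (R : realType) (q : R) n (X : graph n) : 0 < q < 1 ->
  edge_tilt (ln (q / (1 - q))) X = bernoulli_prod (fun=> q) X.
Proof.
move=> /andP[q0 q1]; have q1' : 0 < 1 - q by rewrite subr_gt0.
have E (Y : graph n) : expR (ln (q / (1 - q)) * (num_edges Y)%:R) =
    (1 - q) ^- #|vpair n| * bernoulli_prod (fun=> q) Y.
  rewrite mulrC expRM_natl lnK ?posrE ?divr_gt0//.
  have -> : (q / (1 - q)) ^+ num_edges Y =
      \prod_(e in [pred e | Y e]) (q / (1 - q)) by rewrite prodr_const.
  have -> : (1 - q) ^- #|vpair n| = \prod_(e : vpair n) (1 - q)^-1.
    by rewrite prodr_const exprVn.
  rewrite [LHS]big_mkcond /=.
  rewrite /bernoulli_prod -big_split /=; apply: eq_bigr => e _; rewrite inE.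
  rewrite /bernoulli1; case: ifP => _; first by rewrite mulrC.
  by rewrite mulVf// gt_eqF.
rewrite /edge_tilt; under eq_bigr do rewrite E.
rewrite -big_distrr /= bernoulli_prod_sum mulr1 E mulrC mulKf//.
by rewrite invr_eq0 expf_neq0// gt_eqF.
Qed.

(** * Concentration of the triangle density *)

(** A tuple with a repetition is determined by the pair of positions that agree
    and by its other entries, which bounds the number of such tuples. *)
Lemma expn_le_ffact n m : (n ^ m.+1 <= n ^_ m.+1 + 'C(m.+1, 2) * n ^ m)%N.
Proof.
elim: m => [|m IH]; first by rewrite ffactn1 expn1 addn0.
have ffe k : (n ^_ k <= n ^ k)%N.
  elim: k => // k IHk; by rewrite ffactnSr expnSr leq_mul// ?leq_subr.
rewrite expnSr (leq_trans (leq_mul IH (leqnn n)))// mulnDl -mulnA -expnSr.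
rewrite [n ^_ m.+2]ffactnSr (binS m.+1 1) bin1 mulnDl addnA addnAC leq_add2r.
apply: (@leq_trans (n ^_ m.+1 * (n - m.+1 + m.+1))).
  by rewrite leq_mul// addnC -leq_subLR.
by rewrite mulnDr leq_add2l [leqLHS]mulnC leq_mul.
Qed.

Section six_tuples.
Variable n : nat.
Local Notation T3 := ('I_n * 'I_n * 'I_n)%type.

(** Two triangles as one tuple of vertices. *)
Definition six (z : T3 * T3) : 6.-tuple 'I_n :=
  [tuple z.1.1.1; z.1.1.2; z.1.2; z.2.1.1; z.2.1.2; z.2.2].

Lemma card_not_uniq_six : (#|[pred z | ~~ uniq (six z)]| <= 15 * n ^ 5)%N.
Proof.
have card6 : #|{: T3 * T3}| = (n ^ 6)%N.
  by rewrite !card_prod card_ord !expnS expn0 !muln1 !mulnA.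
have six_bij : bijective six.
  apply: inj_card_bij; last by rewrite card_tuple card6 card_ord.
  by move=> [[[a b] c] [[d e] f]] [[[a' b'] c'] [[d' e'] f']] [-> -> -> -> -> ->].
have cardU : #|[pred z | uniq (six z)]| = n ^_ 6.
  rewrite -[n in RHS]card_ord -(card_uniq_tuples 6 (fun=> true)).
  rewrite -(on_card_preimset (onW_bij _ six_bij)).
  by apply: eq_card => z; rewrite !inE all_predT.
have := cardC [pred z | uniq (six z)]; rewrite cardU card6 => E.
by rewrite -(leq_add2l (n ^_ 6)) E; exact: expn_le_ffact.
Qed.

End six_tuples.

Lemma triangle_avg_pair (R : realType) n (F : 'I_n -> 'I_n -> R) :
  triangle_avg F = n%:R^-1 ^+ 3 *
    \sum_(z : 'I_n * 'I_n * 'I_n) F z.1.1 z.1.2 * F z.1.2 z.2 * F z.1.1 z.2.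
Proof.
rewrite /triangle_avg; congr (_ * _).
rewrite (pair_big xpredT xpredT (fun i j => \sum_l F i j * F j l * F i l)) /=.
by rewrite pair_big /=; apply: eq_bigr => -[[]].
Qed.

Section triangle_moments.
Variables (R : realType) (n : nat) (W : 'I_n -> 'I_n -> R).
Hypothesis W_sym : forall i j, W i j = W j i.
Hypothesis W01 : forall i j, 0 <= W i j <= 1.

Local Notation T3 := ('I_n * 'I_n * 'I_n)%type.

Definition edge_prob (e : vpair n) : R := W (val e).1 (val e).2.

Local Notation mu := (bernoulli_prod edge_prob : graph n -> R).

Definition joins (e : vpair n) (i j : 'I_n) := (val e == (i, j)) || (val e == (j, i)).

Lemma edge_between i j : i != j -> exists e, [/\ joins e i j, edge_prob e = W i j &
  forall X : graph n, adj X i j = X e].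
Proof.
move=> ij; wlog lt_ij : i j ij / (i < j)%N.
  move=> H; case: (ltngtP i j) => [/(H _ _ ij)//|ji|/val_inj E].
    rewrite eq_sym in ij; have [e [eij pe Xe]] := H _ _ ij ji.
    by exists e; split; [rewrite /joins orbC|rewrite W_sym|move=> X; rewrite adj_sym].
  by rewrite E eqxx in ij.
pose e : vpair n := Sub (i, j) lt_ij; exists e; split => //.
  by rewrite /joins eqxx.
move=> X; apply/existsP/idP => [[e' /andP[Xe' /orP[]/eqP E]]|Xe].
- by have -> : e = e' by apply: val_inj; rewrite E.
- by have := valP e'; rewrite E /= ltnNge ltnW.
- by exists e; rewrite Xe eqxx.
Qed.

Lemma joins_neq e e' i j k l : joins e i j -> joins e' k l ->
  (i \notin [:: k; l]) || (j \notin [:: k; l]) -> e != e'.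
Proof.
move=> ij kl H; apply: contraL H => /eqP E; move: ij kl.
rewrite E /joins negb_or !negbK !inE.
by case: (val e') => a b; rewrite !xpair_eqE =>
  /orP[]/andP[/eqP-> /eqP->] /orP[]/andP[/eqP-> /eqP->]; rewrite !eqxx ?orbT.
Qed.

Definition triangle_ind (X : graph n) (z : T3) : R :=
  (adj X z.1.1 z.1.2)%:R * (adj X z.1.2 z.2)%:R * (adj X z.1.1 z.2)%:R.

Definition triangle_prob (z : T3) : R :=
  W z.1.1 z.1.2 * W z.1.2 z.2 * W z.1.1 z.2.

Lemma triangle_edges z : uniq [:: z.1.1; z.1.2; z.2] ->
  exists e1 e2 e3 : vpair n, [/\ uniq [:: e1; e2; e3],
    [/\ joins e1 z.1.1 z.1.2, joins e2 z.1.2 z.2 & joins e3 z.1.1 z.2],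
    triangle_prob z = edge_prob e1 * edge_prob e2 * edge_prob e3 &
    forall X, triangle_ind X z = (all X [:: e1; e2; e3])%:R].
Proof.
case: z => [[i j] l] /=; rewrite !inE !negb_or andbT => /andP[/andP[ij il] jl] /=.
have [e1 [J1 p1 X1]] := edge_between ij; have [e2 [J2 p2 X2]] := edge_between jl.
have [e3 [J3 p3 X3]] := edge_between il.
exists e1, e2, e3; split => //.
- rewrite /= !inE !negb_or andbT.
  rewrite (joins_neq J1 J2) ?(joins_neq J1 J3) ?(joins_neq J2 J3)// !inE.
  + by rewrite !negb_or (eq_sym j i) ij jl.
  + by rewrite !negb_or (eq_sym j i) ij jl orbT.
  + by rewrite !negb_or ij il.
- by rewrite /triangle_prob /= p1 p2 p3.
- by move=> X; rewrite /triangle_ind /= X1 X2 X3 andbT -!natrM !mulnb andbA.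
Qed.

Lemma triangle_ind_mean z : uniq [:: z.1.1; z.1.2; z.2] ->
  \sum_X mu X * triangle_ind X z = triangle_prob z.
Proof.
move=> /triangle_edges[e1 [e2 [e3 [ue _ -> XE]]]].
under eq_bigr do rewrite XE.
by rewrite bernoulli_prod_all// !big_cons big_nil mulr1 mulrA.
Qed.

(** Vertex-disjoint triangles have disjoint edges, hence are independent. *)
Lemma triangle_ind_mean2 z : uniq (six z) ->
  \sum_X mu X * (triangle_ind X z.1 * triangle_ind X z.2) =
  triangle_prob z.1 * triangle_prob z.2.
Proof.
move=> u6; have : uniq (six z) by [].
rewrite -[tval _]/([:: z.1.1.1; z.1.1.2; z.1.2] ++ [:: z.2.1.1; z.2.1.2; z.2.2]).
rewrite cat_uniq => /and3P[/triangle_edges[e1 [e2 [e3 [ue [J1 J2 J3] -> XE]]]] dis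
  /triangle_edges[f1 [f2 [f3 [uf [K1 K2 K3] -> YE]]]]].
have -> : edge_prob e1 * edge_prob e2 * edge_prob e3 *
   (edge_prob f1 * edge_prob f2 * edge_prob f3) =
   \prod_(e <- [:: e1; e2; e3] ++ [:: f1; f2; f3]) edge_prob e.
  by rewrite !big_cons big_nil mulr1 !mulrA.
rewrite -bernoulli_prod_all; last first.
  rewrite cat_uniq ue uf andbT; apply/hasPn => f.
  have outer k : k \in [:: z.2.1.1; z.2.1.2; z.2.2] ->
      k \notin [:: z.1.1.1; z.1.1.2; z.1.2] by move/hasPn: dis; apply.
  have [notin1 notin2 notin3] : [/\ z.2.1.1 \notin [:: z.1.1.1; z.1.1.2; z.1.2],
    z.2.1.2 \notin [:: z.1.1.1; z.1.1.2; z.1.2] &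
    z.2.2 \notin [:: z.1.1.1; z.1.1.2; z.1.2]].
    by split; apply: outer; rewrite !inE eqxx ?orbT.
  have notin_pair k i j : k \notin [:: z.1.1.1; z.1.1.2; z.1.2] ->
     i \in [:: z.1.1.1; z.1.1.2; z.1.2] -> j \in [:: z.1.1.1; z.1.1.2; z.1.2] ->
     k \notin [:: i; j].
    by move=> ko iz jz; rewrite !inE negb_or;
      apply/andP; split; apply: contraNneq ko => ->.
  have i1 : z.1.1.1 \in [:: z.1.1.1; z.1.1.2; z.1.2] by rewrite !inE eqxx.
  have i2 : z.1.1.2 \in [:: z.1.1.1; z.1.1.2; z.1.2] by rewrite !inE eqxx orbT.
  have i3 : z.1.2 \in [:: z.1.1.1; z.1.1.2; z.1.2] by rewrite !inE eqxx !orbT.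
  have key k l : joins f k l -> k \notin [:: z.1.1.1; z.1.1.2; z.1.2] ->
      f \notin [:: e1; e2; e3].
    move=> fkl ko; rewrite !inE !negb_or.
    rewrite (joins_neq fkl J1) ?(joins_neq fkl J2) ?(joins_neq fkl J3)//;
      by rewrite notin_pair.
  rewrite 3!inE => /or3P[]/eqP E; rewrite E in key *.
  - exact: key K1 notin1.
  - exact: key K2 notin2.
  - exact: key K3 notin1.
apply: eq_bigr => X _; congr (_ * _); rewrite XE YE all_cat.
by rewrite -natrM mulnb.
Qed.

Lemma triangle_prob01 z : 0 <= triangle_prob z <= 1.
Proof.
have H i j : 0 <= W i j by case/andP: (W01 i j).
have H' i j : W i j <= 1 by case/andP: (W01 i j).
by rewrite /triangle_prob !mulr_ge0//= !mulr_ile1// ?mulr_ge0.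
Qed.

Lemma triangle_ind01 X z : 0 <= triangle_ind X z <= 1.
Proof. by rewrite /triangle_ind -!natrM !mulnb ler0n lern1 leq_b1. Qed.

Lemma edge_prob01 e : 0 <= edge_prob e <= 1. Proof. exact: W01. Qed.

(** In the expansion of the square, pairs of triangles on six distinct vertices are
    uncorrelated and centred; the other pairs, at most [15 * n ^ 5] of them,
    contribute at most 1 each. *)
Lemma triangle_second_moment :
  \sum_X mu X * (\sum_z (triangle_ind X z - triangle_prob z)) ^+ 2 <=
  (15 * n ^ 5)%:R.
Proof.
pose D X z := triangle_ind X z - triangle_prob z.
have -> : \sum_X mu X * (\sum_z D X z) ^+ 2 =
    \sum_(z : T3 * T3) \sum_X mu X * (D X z.1 * D X z.2).
  rewrite exchange_big /=; apply: eq_bigr => X _; rewrite -big_distrr /=.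
  congr (_ * _); rewrite expr2 big_distrlr /= pair_big /=.
  by apply: eq_bigr => -[].
rewrite (bigID (fun z => uniq (six z))) /= big1 ?add0r; last first.
  move=> z u6; have : uniq (six z) by [].
  rewrite -[tval _]/([:: z.1.1.1; z.1.1.2; z.1.2] ++ [:: z.2.1.1; z.2.1.2; z.2.2]).
  rewrite cat_uniq => /and3P[u1 _ u2].
  transitivity (\sum_X mu X * (triangle_ind X z.1 * triangle_ind X z.2)
    - triangle_prob z.2 * (\sum_X mu X * triangle_ind X z.1)
    - triangle_prob z.1 * (\sum_X mu X * triangle_ind X z.2)
    + triangle_prob z.1 * triangle_prob z.2 * (\sum_X mu X)).
    rewrite !big_distrr /= -!sumrB -big_split /=; apply: eq_bigr => X _.
    by rewrite /D; ring.
  rewrite triangle_ind_mean2// !triangle_ind_mean// bernoulli_prod_sum; ring.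
apply: (@le_trans _ _ (\sum_(z : T3 * T3 | ~~ uniq (six z)) 1)).
  apply: ler_sum => z _; rewrite -(bernoulli_prod_sum edge_prob).
  apply: ler_sum => X _; rewrite ler_piMr//.
    by apply: bernoulli_prod_ge0; exact: edge_prob01.
  have D1 y : `|D X y| <= 1.
    have /andP[? ?] := triangle_ind01 X y; have /andP[? ?] := triangle_prob01 y.
    by rewrite ler_norml /D; apply/andP; split; lra.
  by apply: le_trans (ler_norm _) _; rewrite normrM mulr_ile1.
rewrite sumr_const ler_nat; apply: leq_trans (card_not_uniq_six n).
by apply/eq_leq/eq_card => z; rewrite !inE.
Qed.

(** Chebyshev's inequality. *)
Lemma triangle_avg_concentration (d : R) : (0 < n)%N -> 0 < d ->
  \sum_(X : graph n | graph_triangle_avg R X < triangle_avg W - d) mu X <=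
    15 / (n%:R * d ^+ 2).
Proof.
move=> n0 d0; have nR : 0 < n%:R :> R by rewrite ltr0n.
have mu0 X : 0 <= mu X by apply: bernoulli_prod_ge0; exact: edge_prob01.
have c0 : 0 <= n%:R^-1 ^+ 6 / d ^+ 2 :> R.
  by rewrite divr_ge0 ?exprn_ge0 ?invr_ge0// ltW.
apply: (@le_trans _ _ (n%:R^-1 ^+ 6 / d ^+ 2 * (15 * n ^ 5)%:R)); last first.
  rewrite natrM natrX le_eqVlt; apply/orP; left; apply/eqP; field.
  by rewrite !gt_eqF.
apply: (@le_trans _ _ (n%:R^-1 ^+ 6 / d ^+ 2 *
    \sum_X mu X * (\sum_z (triangle_ind X z - triangle_prob z)) ^+ 2)); last first.
  by rewrite ler_wpM2l ?triangle_second_moment.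
rewrite big_distrr /= [leLHS]big_mkcond /=; apply: ler_sum => X _.
have s0 : 0 <= n%:R^-1 ^+ 6 / d ^+ 2 * (mu X *
    (\sum_z (triangle_ind X z - triangle_prob z)) ^+ 2).
  by apply: mulr_ge0 => //; rewrite mulr_ge0 ?sqr_ge0.
case: ifP => // Xd; rewrite mulrCA ler_peMr//.
have -> : n%:R^-1 ^+ 6 / d ^+ 2 * (\sum_z (triangle_ind X z - triangle_prob z)) ^+ 2 =
  ((graph_triangle_avg R X - triangle_avg W) / d) ^+ 2.
  have -> : graph_triangle_avg R X - triangle_avg W =
      n%:R^-1 ^+ 3 * \sum_z (triangle_ind X z - triangle_prob z).
    by rewrite /graph_triangle_avg !triangle_avg_pair -mulrBr -sumrB.
  by move: (\sum_z _) => S; field; rewrite !gt_eqF.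
rewrite -sqrrN -mulNr; apply: exprn_ege1; rewrite ler_pdivlMr//.
by move: Xd; move: (graph_triangle_avg _ _) (triangle_avg _) => x y; lra.
Qed.

End triangle_moments.

(** * The change of measure *)

Section vertex_pairs.
Variables (R : realType) (n : nat).

Lemma sum_vpair (F : 'I_n * 'I_n -> R) :
  \sum_(e : vpair n) F (val e) = \sum_(z : 'I_n * 'I_n | (z.1 < z.2)%N) F z.
Proof.
rewrite (reindex_omap (val : vpair n -> _) insub) /=; last first.
  by move=> z zlt; rewrite insubT.
by apply: eq_bigl => e; rewrite valK eqxx andbT; apply/esym/(valP e).
Qed.

Lemma sum_vpair_sym (F : 'I_n -> 'I_n -> R) : (forall i j, F i j = F j i) ->
  \sum_(e : vpair n) 2 * F (val e).1 (val e).2 =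
  \sum_i \sum_j F i j - \sum_i F i i.
Proof.
move=> Fsym; rewrite (sum_vpair (fun z => 2 * F z.1 z.2)).
rewrite (pair_big xpredT xpredT F) /=.
rewrite [X in _ = X - _](bigID (fun z : 'I_n * 'I_n => (z.1 < z.2)%N)) /=.
rewrite [X in _ = (_ + X) - _](bigID (fun z : 'I_n * 'I_n => z.1 == z.2)) /=.
have -> : \sum_(z : 'I_n * 'I_n | ~~ (z.1 < z.2)%N && (z.1 == z.2)) F z.1 z.2 =
    \sum_i F i i.
  rewrite (reindex_omap (fun i => (i, i)) (fun z => Some z.1)) /=.
    by apply: eq_bigl => i; rewrite ltnn !eqxx.
  by move=> [i j] /= /andP[_ /eqP ->].
have -> : \sum_(z : 'I_n * 'I_n | ~~ (z.1 < z.2)%N && (z.1 != z.2)) F z.1 z.2 =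
    \sum_(z : 'I_n * 'I_n | (z.1 < z.2)%N) F z.1 z.2.
  rewrite (reindex_inj (h := fun z : 'I_n * 'I_n => (z.2, z.1))); last first.
    by move=> [i j] [i' j'] /= [-> ->].
  apply: eq_big => [[i j]|[i j] _] /=; last exact: Fsym.
  by rewrite -leqNgt [RHS]ltn_neqAle andbC eq_sym.
by rewrite -big_distrr /=; ring.
Qed.

End vertex_pairs.

Lemma ln_prod (R : realType) (I : finType) (F : I -> R) : (forall i, 0 < F i) ->
  ln (\prod_i F i) = \sum_i ln (F i).
Proof.
move=> F0.
suff [] : 0 < \prod_i F i /\ ln (\prod_i F i) = \sum_i ln (F i) by [].
apply: (big_rec2 (fun x y => 0 < x /\ ln x = y)); first by rewrite ln1.
by move=> i y x _ [x0 <-]; rewrite mulr_gt0// lnM ?posrE.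
Qed.

(** On [A] use [ln y <= y - 1] at [y = w * expR (- s) / mu], whose [mu]-sum
    over [A] is at most 1; off [A] use the pointwise bound [C]. In words: if
    [mu] nearly charges [A] only, the mass [w] of [A] is at least the exponential
    of minus the relative entropy of [mu] with respect to [w], up to small
    errors. *)
Lemma gibbs_lower_bound (R : realType) (T : finType) (w mu : T -> R) (A : pred T)
    (C s : R) :
  (forall x, 0 < w x) -> (forall x, 0 < mu x) -> \sum_x mu x = 1 ->
  (forall x, ln (w x) - ln (mu x) <= C) -> \sum_(x | A x) w x <= expR s ->
  \sum_x mu x * (ln (w x) - ln (mu x)) <=
    s * \sum_(x | A x) mu x + C * \sum_(x | ~~ A x) mu x + 1.
Proof.
move=> w0 mu0 mu1 wC wA; rewrite (bigID A) /=.
have hC : \sum_(x | ~~ A x) mu x * (ln (w x) - ln (mu x)) <=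
    C * \sum_(x | ~~ A x) mu x.
  rewrite big_distrr /=; apply: ler_sum => x _.
  by rewrite mulrC ler_wpM2r// ltW.
have hA : \sum_(x | A x) mu x * (ln (w x) - ln (mu x)) <=
    s * \sum_(x | A x) mu x + expR (- s) * \sum_(x | A x) w x.
  rewrite !big_distrr -big_split /=; apply: ler_sum => x _.
  have yx0 : 0 < w x * expR (- s) / mu x by rewrite divr_gt0// mulr_gt0// expR_gt0.
  have h : ln (w x * expR (- s) / mu x) <= w x * expR (- s) / mu x - 1.
    have := @le_ln1Dx R (w x * expR (- s) / mu x - 1).
    by rewrite [1 + _]addrC subrK; apply; rewrite ltrBDr addNr.
  rewrite ln_div ?posrE ?mulr_gt0 ?expR_gt0// lnM ?posrE ?expR_gt0// expRK in h.
  have := ler_wpM2l (ltW (mu0 x)) h.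
  have -> : mu x * (w x * expR (- s) / mu x - 1) = expR (- s) * w x - mu x.
    by field; rewrite gt_eqF.
  have := ltW (mu0 x); move: (ln (w x)) (ln (mu x)) => a b.
  move: (mu x) (_ * w x) => m y m0.
  have -> : m * (a - s - b) = m * (a - b) - s * m by ring.
  by move: (m * _) (s * m) => c d; lra.
have : expR (- s) * \sum_(x | A x) w x <= 1.
  by rewrite expRN mulrC ler_pdivrMr ?mul1r ?expR_gt0.
by move: (s * _) (C * _) hC hA => x y; lra.
Qed.

(** * Blow-ups of a step matrix *)

Section blocks.
Variable R : realType.

Lemma sum_mod_block (G : nat -> R) m k :
  \sum_(i < m * k.+1) G (i %% k.+1)%N = m%:R * \sum_(j < k.+1) G j.
Proof.
elim: m => [|m IH]; first by rewrite big_ord0 mul0r.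
rewrite mulSn big_split_ord /= -natr1 mulrDl mul1r addrC; congr (_ + _).
  by rewrite -IH; apply: eq_bigr => i _; rewrite modnDl.
by apply: eq_bigr => i _; rewrite modn_small.
Qed.

(** Vertices are spread over the [k + 1] blocks by residue, so all blocks have
    exactly [m] vertices. *)
Definition block k m (i : 'I_(m * k.+1)) : 'I_k.+1 := inord (i %% k.+1).

Lemma sum_block k m (F : 'I_k.+1 -> R) :
  \sum_(i < m * k.+1) F (block i) = m%:R * \sum_j F j.
Proof.
rewrite (sum_mod_block (fun i => F (inord i))); congr (_ * _).
by apply: eq_bigr => j _; rewrite inord_val.
Qed.

Lemma triangle_avg_block k m (w : 'I_k.+1 -> 'I_k.+1 -> R) :
  triangle_avg (fun i j : 'I_(m.+1 * k.+1) => w (block i) (block j)) = triangle_avg w.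
Proof.
rewrite /triangle_avg.
have -> : \sum_(i < m.+1 * k.+1) \sum_(j < m.+1 * k.+1) \sum_(l < m.+1 * k.+1)
    w (block i) (block j) * w (block j) (block l) * w (block i) (block l) =
  m.+1%:R ^+ 3 * \sum_i \sum_j \sum_l w i j * w j l * w i l.
  under eq_bigr do under eq_bigr do
    rewrite (sum_block _ (fun l =>
      w (block _) (block _) * w (block _) l * w (block _) l)).
  under eq_bigr do
    rewrite (sum_block _ (fun j =>
      m.+1%:R * \sum_l w (block _) j * w j l * w (block _) l)).
  rewrite (sum_block _ (fun i =>
    m.+1%:R * \sum_j (m.+1%:R * \sum_l w i j * w j l * w i l))).
  rewrite -big_distrr /= !mulrA -mulrA.
  under eq_bigr do rewrite -big_distrr /=.
  by rewrite -big_distrr /= !mulrA !exprS expr0 mulr1 !mulrA.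
have [m0 k0] : (m.+1%:R : R) != 0 /\ (k.+1%:R : R) != 0 by rewrite !pnatr_eq0.
rewrite natrM mulrA; congr (_ * _); move: (m.+1%:R) (k.+1%:R) m0 k0 => x y x0 y0.
by field; rewrite x0 y0.
Qed.

Lemma sum_block2 k m (F : 'I_k.+1 -> 'I_k.+1 -> R) :
  \sum_(i < m.+1 * k.+1) \sum_(j < m.+1 * k.+1) F (block i) (block j) =
  (m.+1 * k.+1)%:R ^+ 2 * (k.+1%:R^-1 ^+ 2 * \sum_i \sum_j F i j).
Proof.
under eq_bigr do rewrite (sum_block _ (F (block _))).
rewrite (sum_block _ (fun i => m.+1%:R * \sum_j F i j)) -big_distrr /= natrM.
have k0 : (k.+1%:R : R) != 0 by rewrite pnatr_eq0.
by move: (\sum_i _) (m.+1%:R) (k.+1%:R) k0 => S x y y0; field.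
Qed.

End blocks.

(** * The second moment along blow-ups *)

(** The real arithmetic of [step_lower_bound]: [N] is the number of vertices,
    [Jb] the tilted rate of the matrix, [cc] a bound on [- c], [eps] the
    probability of missing the triangle constraint, at most [D / N], and [S] the
    diagonal terms, absent from the sum over pairs of vertices. *)
Lemma lower_bound_arith (R : realType) (N Jb c cc eps B C D S : R) :
  0 < N -> 1 <= N -> 0 <= eps -> eps * N <= D -> 0 <= B -> 0 <= C -> 0 <= D ->
  - c <= cc -> 0 <= cc -> - S <= N * B ->
  - (N ^+ 2 * Jb - S) <= N ^+ 2 * c * (1 - eps) + N ^+ 2 * C * eps + 1 ->
  - Jb <= c + (B + 1 + D * (1 + C)) * (1 + cc) / N.
Proof.
move=> n0 n1 eps0 epsn B0 C0 D0 cn nc diag G.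
rewrite -(ler_pM2r (exprn_gt0 2 n0)).
have -> : (c + (B + 1 + D * (1 + C)) * (1 + cc) / N) * N ^+ 2 =
   N ^+ 2 * c + N * ((B + 1 + D * (1 + C)) * (1 + cc)).
  by field; rewrite gt_eqF.
have e1 : N ^+ 2 * - c * eps <= N * D * cc.
  apply: (@le_trans _ _ (N ^+ 2 * cc * eps)).
    by rewrite ler_wpM2r// ler_wpM2l// exprn_ge0// ltW.
  have -> : N ^+ 2 * cc * eps = N * ((eps * N) * cc) by ring.
  by rewrite -[leRHS]mulrA ler_wpM2l ?(ltW n0)// ler_wpM2r.
have e2 : N ^+ 2 * C * eps <= N * D * C.
  have -> : N ^+ 2 * C * eps = N * ((eps * N) * C) by ring.
  by rewrite -[leRHS]mulrA ler_wpM2l ?(ltW n0)// ler_wpM2r.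
have e3 : N * ((B + 1 + D * (1 + C)) * (1 + cc)) =
   N * B + N + N * D * C + N * D * cc +
   N * (B * cc + cc + D + D * C * cc) by ring.
have e4 : 0 <= N * (B * cc + cc + D + D * C * cc).
  by rewrite mulr_ge0 ?(ltW n0)// !addr_ge0// !mulr_ge0.
rewrite e3; move: G e1 e2.
have -> : N ^+ 2 * c * (1 - eps) = N ^+ 2 * c + N ^+ 2 * - c * eps by ring.
move: (N ^+ 2 * - c * eps) (N ^+ 2 * C * eps) (N ^+ 2 * c) => x y z.
rewrite mulNr [Jb * _]mulrC; move: (N ^+ 2 * Jb) => jj.
move: (N * (B * cc + cc + D + D * C * cc)) e4 => r r0 G e1 e2.
move: diag; move: (N * B) (N * D * C) (N * D * cc) e1 e2 => nB v1 v2 diag e1 e2; lra.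
Qed.

Definition second_moment (R : realType) (p t : R) (Q : forall n, graph n -> R)
    (n : nat) : R :=
  expectation_mass (@Q n) (fun X => importance_weight p t (@Q n) X ^+ 2).

Section lower_bound.
Variables (R : realType) (p q t : R).
Hypotheses (p01 : 0 < p < 1) (q01 : 0 < q < 1).
Local Notation Q := (edge_tilt (ln (q / (1 - q)))).

Definition likelihood_sqr n (X : graph n) : R :=
  bernoulli_prod (fun=> p) X ^+ 2 / bernoulli_prod (fun=> q) X.

(** On the upper tail, [Q * (P / Q) ^ 2 = P ^ 2 / Q]. *)
Lemma second_momentE n : second_moment p t Q n.+1 =
  \sum_(X : graph n.+1 | t ^+ 3 <= graph_triangle_avg R X) likelihood_sqr X.
Proof.
rewrite /second_moment /expectation_mass [RHS]big_mkcond /=; apply: eq_bigr => X _.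
rewrite edge_tilt_bernoulli// /importance_weight edge_tilt_bernoulli// indicE.
have q0 : bernoulli_prod (fun=> q) X != 0 by rewrite gt_eqF// bernoulli_prod_gt0.
rewrite /likelihood_sqr -[erdos_renyi p X]/(bernoulli_prod (fun=> p) X).
case: ifP => [tX|tX].
  rewrite mem_set /= ?mul1r; first by field.
  exact/graph_upper_tail.
rewrite memNset /= ?mul0r ?expr0n /= ?mulr0//.
by move=> /graph_upper_tail; rewrite tX.
Qed.

Variables (a : R) (k : nat) (w : 'I_k.+1 -> 'I_k.+1 -> R).
Hypothesis a0 : 0 < a.
Hypothesis w_sym : forall i j, w i j = w j i.
Hypothesis wI : forall i j, a <= w i j <= 1 - a.
Hypothesis tw : t ^+ 3 < triangle_avg w.

Local Notation J := (k.+1%:R^-1 ^+ 2 * \sum_i \sum_j tilted_rate p q (w i j)).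

Let w01 i j : 0 < w i j < 1.
Proof.
by have /andP[aw wa] := wI i j; rewrite (lt_le_trans a0 aw) (le_lt_trans wa)// gtrBl.
Qed.

(** Change of measure to the product law whose edge probabilities are the entries
    of the blown-up matrix. The triangle density concentrates at
    [triangle_avg w > t ^ 3], so this law nearly charges the upper tail only, and
    its relative entropy with respect to [P ^ 2 / Q] is [n ^ 2 * J] up to [O(n)].
    The bound is stated for an arbitrary exponent [c] with error [O(1 / n)]. *)
Lemma step_lower_bound : exists2 K : R, 0 <= K & forall m c,
  second_moment p t Q (m.+1 * k.+1) <= expR ((m.+1 * k.+1)%:R ^+ 2 * c) ->
  - J <= c + K * (1 + `|c|) / (m.+1 * k.+1)%:R.
Proof.
have [[p0 p1] [q0 q1]] := (andP p01, andP q01).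
have [lp lq] : ln p <= 0 /\ ln q <= 0 by rewrite !ln_le0// ltW.
have [lp' lq'] : ln (1 - p) <= 0 /\ ln (1 - q) <= 0 by rewrite !ln_le0// gerBl ltW.
have la : ln a <= 0.
  have /andP[aw _] := wI ord0 ord0; have /andP[_ w1] := w01 ord0 ord0.
  by rewrite ln_le0// (le_trans aw)// ltW.
pose d := triangle_avg w - t ^+ 3; have d0 : 0 < d by rewrite subr_gt0.
pose B := 2^-1 * (- ln q - ln (1 - q)).
pose C := - ln q - ln (1 - q) - ln a.
have B0 : 0 <= B by rewrite mulr_ge0// ?invr_ge0//; lra.
have C0 : 0 <= C by rewrite /C; lra.
have D0 : 0 <= 15 / d ^+ 2 by rewrite divr_ge0// exprn_ge0// ltW.
exists (B + 1 + 15 / d ^+ 2 * (1 + C)).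
  by rewrite addr_ge0 ?addr_ge0//; apply: mulr_ge0 => //; rewrite addr_ge0.
move=> m c; set n := (m.+1 * k.+1)%N.
have n0 : 0 < n%:R :> R by rewrite ltr0n.
have n1 : 1 <= n%:R :> R by rewrite ler1n.
rewrite (second_momentE (k + m * k.+1)) -/n => HW.
pose W (i j : 'I_n) := w (block i) (block j).
have W_sym i j : W i j = W j i by exact: w_sym.
have W01 i j : 0 <= W i j <= 1.
  by case/andP: (w01 (block i) (block j)) => /ltW-> /ltW->.
pose mu := bernoulli_prod (edge_prob W) : graph n -> R.
have mu0 X : 0 < mu X by apply: bernoulli_prod_gt0 => e; exact: w01.
(* The contribution of one edge to the logarithm of (P ^ 2 / Q) / mu. *)
pose h (e : vpair n) b := 2 * ln (bernoulli1 p b) - ln (bernoulli1 q b) -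
   ln (bernoulli1 (edge_prob W e) b).
have b0 r b : 0 < r < 1 -> 0 < bernoulli1 r b :> R.
  by move=> /andP[? ?]; case: b; rewrite /= ?subr_gt0.
have llr (X : graph n) : ln (likelihood_sqr X) - ln (mu X) = \sum_e h e (X e).
  have e0 r : 0 < r < 1 -> 0 < bernoulli_prod (fun=> r) X.
    by move=> r01; exact: bernoulli_prod_gt0.
  rewrite /likelihood_sqr ln_div ?posrE ?exprn_gt0 ?e0// lnXn ?e0// -mulr_natl.
  have we (e : vpair n) : 0 < edge_prob W e < 1 by exact: w01.
  rewrite /mu /bernoulli_prod (ln_prod (fun e => b0 _ (X e) p01)).
  rewrite (ln_prod (fun e => b0 _ (X e) q01)) (ln_prod (fun e => b0 _ (X e) (we e))).
  by rewrite big_distrr /= -!sumrB.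
have hC e b : h e b <= C.
  have := wI (block (val e).1) (block (val e).2) => /andP[aw wa].
  rewrite /h /C; case: b => /=; rewrite /bernoulli1 /edge_prob /W.
    have : ln a <= ln (w (block (val e).1) (block (val e).2)).
      by rewrite ler_ln ?posrE//; exact: lt_le_trans aw.
    by move: (ln (w _ _)) => x ax; lra.
  have a1w : a <= 1 - w (block (val e).1) (block (val e).2).
    by rewrite lerBrDr addrC -lerBrDr.
  have : ln a <= ln (1 - w (block (val e).1) (block (val e).2)).
    by rewrite ler_ln ?posrE//; exact: lt_le_trans a1w.
  by move: (ln (1 - w _ _)) => x ax; lra.
have NE : (#|vpair n|%:R : R) <= n%:R ^+ 2.
  rewrite -natrX ler_nat card_sig; apply: leq_trans (max_card _) _.
  by rewrite card_prod card_ord expnS expn1.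
have llrC (X : graph n) : ln (likelihood_sqr X) - ln (mu X) <= n%:R ^+ 2 * C.
  rewrite llr; apply: (@le_trans _ _ (\sum_(e : vpair n) C)).
    by apply: ler_sum => e _; exact: hC.
  by rewrite sumr_const -[leLHS]mulr_natl ler_wpM2r.
have lik0 (X : graph n) : 0 < likelihood_sqr X :> R.
  by rewrite divr_gt0 ?exprn_gt0//; apply: bernoulli_prod_gt0.
(* With [s = n ^ 2 * c] and the pointwise bound [n ^ 2 * C] on the log-ratio. *)
have := gibbs_lower_bound lik0 mu0 (bernoulli_prod_sum _) llrC HW.
have -> : \sum_(X : graph n) mu X * (ln (likelihood_sqr X) - ln (mu X)) =
    - (n%:R ^+ 2 * J - \sum_i tilted_rate p q (W i i)).
  under eq_bigr do rewrite llr.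
  rewrite bernoulli_prod_coord -sum_block2.
  rewrite -(sum_vpair_sym (F := fun i j => tilted_rate p q (W i j))).
    rewrite -sumrN; apply: eq_bigr => e _; rewrite -/(edge_prob W e).
    rewrite /h /= /tilted_rate /rate.
    have /andP[u0 u1] := w01 (block (val e).1) (block (val e).2).
    rewrite -[w _ _]/(edge_prob W e) in u0 u1; move: (edge_prob W e) u0 u1 => u u0 u1.
    by rewrite !mul_ln_div ?subr_ge0 ?subr_gt0 ?(ltW u0) ?(ltW u1)//; field.
  by move=> i j; rewrite W_sym.
have diag : - \sum_i tilted_rate p q (W i i) <= n%:R * B.
  rewrite -sumrN; apply: (@le_trans _ _ (\sum_(i < n) B)); last first.
    by rewrite sumr_const card_ord mulr_natl.
  apply: ler_sum => i _; rewrite /tilted_rate.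
  have := rate_ub q01 (W01 i i); have := rate_ge0 p01 (W01 i i); rewrite -/B.
  by move: (rate p _) (rate q _) => x y; lra.
have concentr : \sum_(X : graph n | ~~ (t ^+ 3 <= graph_triangle_avg R X)) mu X
    <= 15 / (n%:R * d ^+ 2).
  have := @triangle_avg_concentration R n W W_sym W01 d isT d0.
  rewrite triangle_avg_block /d opprB addrC subrK.
  by under eq_bigl do rewrite ltNge.
have musum : \sum_(X : graph n | t ^+ 3 <= graph_triangle_avg R X) mu X =
   1 - \sum_(X : graph n | ~~ (t ^+ 3 <= graph_triangle_avg R X)) mu X.
  apply/eqP; rewrite eq_sym subr_eq; apply/eqP.
  by rewrite -[LHS](bernoulli_prod_sum (edge_prob W)); exact: bigID.
rewrite musum; move: concentr.
have eps0 : 0 <= \sum_(X : graph n | ~~ (t ^+ 3 <= graph_triangle_avg R X)) mu X.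
  by apply: sumr_ge0 => X _; exact: ltW.
move: eps0; set eps := \sum_(X : graph n | ~~ _) _; clearbody eps => eps0 epsn.
move: diag; set S := \sum_(i < n) _; move=> diag G.
apply: (lower_bound_arith n0 n1 eps0 _ B0 C0 _ _ _ _ G) => //.
- rewrite -ler_pdivlMr//; apply: le_trans epsn _.
  by rewrite invfM mulrA mulrAC.
- by rewrite -normrN ler_norm.
Qed.

End lower_bound.

(** * Failure of asymptotic optimality *)

Lemma adj_irrefl n (X : graph n) i : adj X i i = false.
Proof.
apply/negbTE/existsP => -[e /andP[_]]; rewrite orbb => /eqP ei.
by have := valP e; rewrite ei /= ltnn.
Qed.

(** Graphs have no loops, so the diagonal of the cube is missed. *)
Lemma triangle_avg_adj_lt1 (R : realType) n (X : graph n.+1) :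
  graph_triangle_avg R X < 1.
Proof.
have n0 : 0 < n.+1%:R :> R by rewrite ltr0n.
rewrite /graph_triangle_avg triangle_avg_pair (bigD1 (ord0, ord0, ord0))//=.
rewrite adj_irrefl !mul0r add0r.
rewrite exprVn mulrC ltr_pdivrMr ?exprn_gt0// mul1r.
apply: (@le_lt_trans _ _ (\sum_(z : 'I_n.+1 * 'I_n.+1 * 'I_n.+1 |
    z != (ord0, ord0, ord0)) (1 : R))).
  by apply: ler_sum => z _; rewrite -!natrM !mulnb lern1 leq_b1.
rewrite sumr_const cardC1 !card_prod card_ord -natrX ltr_nat.
by rewrite !expnS expn0 muln1 !mulnA prednK ?muln_gt0.
Qed.

(** Convergence to a finite limit forces the second moment to be positive, as
    [lne 0] is infinite, and bounds its exponential rate. *)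
Lemma asymptotically_optimal_bound (R : realType) (p t phi e : R)
    (Q : forall n, graph n -> R) :
  ereal_inf (graphon_rate p @` upper_tail t) = phi%:E ->
  asymptotically_optimal p t Q -> 0 < e ->
  exists N, forall n, (N <= n)%N -> (0 < n)%N ->
    0 < second_moment p t Q n <= expR (n%:R ^+ 2 * (- (2 * phi) + e)).
Proof.
move=> infE; rewrite /asymptotically_optimal infE -EFinM -EFinN.
rewrite -[X in X @ \oo --> _]/(fun n =>
  ((n%:R ^+ 2)^-1%:E * lne (second_moment p t Q n)%:E)%E).
move=> /fine_cvgP[fin] /cvgrPdist_lt lim e0.
have [N _ HN] : \forall n \near \oo,
    ((n%:R ^+ 2)^-1%:E * lne (second_moment p t Q n)%:E)%E \is a fin_num /\
    `|- (2 * phi) - fine ((n%:R ^+ 2)^-1%:E * lne (second_moment p t Q n)%:E)%E| < e.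
  by near=> n; split; near: n; [exact: fin|exact: lim].
exists N => n Nn n0; have /= [] := HN n Nn.
set W := second_moment _ _ _ _.
have n20 : 0 < n%:R ^+ 2 :> R by rewrite exprn_gt0// ltr0n.
have [W0|W0] := leP W 0.
  by rewrite gt0_muleNy ?lte_fin ?invr_gt0.
move=> _; rewrite -EFinM /= => h.
rewrite -[leLHS]lnK ?posrE// ler_expR.
have -> : ln W = n%:R ^+ 2 * ((n%:R ^+ 2)^-1 * ln W) by rewrite mulVKf ?gt_eqF.
rewrite ler_pM2l//; move: h; rewrite ltr_norml => /andP[h _].
by move: h; move: (_ * ln W) => x; lra.
Unshelve. all: by end_near.
Qed.

Theorem proposition3p4 (R : realType) (p t q : R)
    (hp : 0 < p < 1) (hpt : p < t) (ht : t <= 1)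
    (hq : 0 < q < 1) (hqt : q <> t) :
  ~ asymptotically_optimal p t (edge_tilt (ln (q / (1 - q)))).
Proof.
move=> opt; have [p0 p1] := andP hp; have t0 := lt_trans p0 hpt.
have t01 : 0 <= t <= 1 by rewrite ht ltW.
have [phi [infE phit near]] := upper_tail_rate_inf hp t01.
have bound := asymptotically_optimal_bound infE opt.
(* For [t = 1] the event is empty for every [n], while the infimum is finite. *)
have [t1|t1] := eqVneq t 1.
  have [N /(_ N.+1 (leqnSn N) isT) /andP[W0 _]] := bound 1 ltr01.
  move: W0; rewrite second_momentE// big_pred0 ?ltxx// => X.
  by apply/negbTE; rewrite -ltNge t1 expr1n triangle_avg_adj_lt1.
have {}t1 : t < 1 by rewrite lt_neqAle t1.
have t01' : 0 < t < 1 by rewrite t0.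
have [g [kg tg gphi]] := tilted_rate_gap hp hq hpt ht hqt phit near.
have [a [k [w [a0 wsym wI tw Jphi]]]] := step_matrix_gap hp hq t01' kg tg gphi.
have [K K0 HK] := step_lower_bound hp hq a0 wsym wI tw.
move: HK Jphi; move: (_ * \sum_i _) => J HK Jphi.
(* Half of the gap is spent on the limit, the other half on the [O(1 / n)] error. *)
pose e := (2 * phi - J) / 2; have e0 : 0 < e by rewrite divr_gt0// subr_gt0.
have [N HN] := bound e e0.
pose c := - (2 * phi) + e.
pose m := maxn N (Num.truncn (K * (1 + `|c|) / e)).
have Nn : (N <= m.+1 * k.+1)%N.
  apply: (@leq_trans m); first exact: leq_maxl.
  by rewrite (leq_trans (leqnSn m))// leq_pmulr.
have /andP[_ /(HK m c)] := HN _ Nn isT.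
have n0 : 0 < (m.+1 * k.+1)%:R :> R by rewrite ltr0n.
have : K * (1 + `|c|) / (m.+1 * k.+1)%:R < e.
  rewrite ltr_pdivrMr// [e * _]mulrC -ltr_pdivrMr//.
  apply: lt_le_trans (Num.Theory.truncnS_gt _) _; rewrite ler_nat.
  by apply: (@leq_trans m.+1); rewrite ?leq_pmulr// ltnS leq_maxr.
move: (_ / _%:R) => x xe; have : e * 2 = 2 * phi - J by rewrite divfK.
by rewrite /c; move: xe; clear; lra.
Qed.
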